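(* Let $G$ be the free semigroup generated by continuous maps $f_1,\dots,f_m$ acting on a compact metric space $(X,d)$, and let $\mu$ be a Borel probability measure on $X$ with full support. If $h(\omega,x)\ge h_{top}(G)$ for $\mathbb{P}\times\mu$-almost every $(\omega,x)\in\Sigma_m^+\times X$, then for every real $q$ with $0\le q\le1$ the entropy $h_{cor}(G,\mu,q)$ exists (i.e. $\overline{h}_{cor}(G,\mu,q)=\underline{h}_{cor}(G,\mu,q)$) and $$h_{top}(G)=h_{cor}(G,\mu,q).$$ Moreover, if $\mu$ is in addition $G$-invariant, then $$h_{top}(G)=h_{cor}(G,\mu,1)=h_\mu(G).$$
   Context: Setting. $(X,d)$ is a compact metric space, $f_1,\dots,f_m:X\to X$ are continuous, $G$ is the free semigroup generated by $\{f_1,\dots,f_m\}$ acting on $X$. Fix a probability vector $p=(p_1,\dots,p_m)$ with all $p_i>0$ and $\sum_i p_i=1$; let $\Sigma_m^+=\{1,\dots,m\}^{\mathbb{N}}$, let $\mathbb{P}$ be the Bernoulli (product) measure on $\Sigma_m^+$ generated by $p$, and let $\sigma$ be the left shift on $\Sigma_m^+$. For $\omega=(i_1,i_2,\dots)\in\Sigma_m^+$ put $f_{\omega,0}=\mathrm{id}$ and $f_{\omega,n}=f_{i_n}\circ\cdots\circ f_{i_1}$ for $n\ge1$. For $k\ge 1$ put $$d^G_{\omega,k}(x,y)=\max_{0\le i\le k-1} d(f_{\omega,i}(x),f_{\omega,i}(y)),\qquad B^G_{\omega,k}(x,\varepsilon)=\{y\in X: d^G_{\omega,k}(x,y)\le\varepsilon\}.$$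 The skew product is $F(\omega,x)=(\sigma(\omega),f_{\omega,1}(x))$ on $\Sigma_m^+\times X$. A Borel probability measure $\mu$ on $X$ is $G$-invariant if $\mathbb{P}\times\mu$ is $F$-invariant. Lower local entropy. $h(\omega,x)=\lim_{\varepsilon\to0}\liminf_{k\to+\infty}-\frac1k\log\mu(B^G_{\omega,k}(x,\varepsilon))$. Topological entropy. A set $E\subseteq X$ is $(\omega,k,\varepsilon)$-separated if $d^G_{\omega,k}(x,y)>\varepsilon$ for all distinct $x,y\in E$; $E(\omega,k,\varepsilon)$ denotes such a set of largest cardinality. Then $h_{top}(G)=\lim_{\varepsilon\to0}\liminf_{k\to+\infty}\frac1k\int_{\Sigma_m^+}\log\sharp E(\omega,k,\varepsilon)\,d\mathbb{P}(\omega)$. Measure-theoretic entropy (for $G$-invariant $\mu$). For a finite Borel measurable partition $\xi$ of $X$, $h_\mu(G,\xi)=\lim_{k\to+\infty}\frac1k\int_{\Sigma_m^+}H_\mu\big(\bigvee_{i=0}^{k-1}f_{\omega,i}^{-1}\xi\big)d\mathbb{P}(\omega)$, where $H_\mu(\eta)=-\sum_{A\in\eta}\mu(A)\log\mu(A)$; $h_\mu(G)=\sup_\xi h_\mu(G,\xi)$. Correlation entropy. For $q\neq1$, $c(G,\mu,\varepsilon,k,q)=\frac1{q-1}\int_{\Sigma_m^+}\log\big(\int_X\mu(B^G_{\omega,k}(x,\varepsilon))^{q-1}d\mu(x)\big)d\mathbb{P}(\omega)$, and $c(G,\mu,\varepsilon,k,1)=\int_{\Sigma_m^+}\int_X\log\mu(B^G_{\omega,k}(x,\varepsilon))\,d\mu(x)\,d\mathbb{P}(\omega)$.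 Then $\overline{h}_{cor}(G,\mu,q)=\lim_{\varepsilon\to0}\limsup_{k\to+\infty}-\frac1kc(G,\mu,\varepsilon,k,q)$ and $\underline{h}_{cor}(G,\mu,q)=\lim_{\varepsilon\to0}\liminf_{k\to+\infty}-\frac1kc(G,\mu,\varepsilon,k,q)$; if they coincide the common value is $h_{cor}(G,\mu,q)$. *)

(* Defs.v *)
From HB Require Import structures.
From mathcomp Require Import all_boot all_order all_algebra finmap.
From mathcomp Require Import all_classical all_reals all_analysis.

Set Implicit Arguments.
Unset Strict Implicit.
Unset Printing Implicit Defensive.

Import Order.TTheory GRing.Theory Num.Theory.
Import numFieldNormedType.Exports.

Local Open Scope classical_set_scope.
Local Open Scope ring_scope.

(* The base point only reflects that measurable types are pointed in the
   library; a space carrying a probability measure is nonempty. *)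
#[short(type="pmetricType")]
HB.structure Definition PMetric (K : numDomainType) :=
  {M of Metric K M & Pointed M}.

Notation borelType X := (g_sigma_algebraType (@open X)).

HB.instance Definition _ (m : nat) := isPointed.Build 'I_m.+1 ord0.

Section symbolic_space.
Variable m : nat.

(* There are m.+1 >= 1 symbols; the letter i_n of a word is [w n.-1]. *)
Definition coordinate_sets : set (set (nat -> 'I_m.+1)) :=
  [set A | exists i j, A = [set w | w i = j]].

Definition shift (w : nat -> 'I_m.+1) : nat -> 'I_m.+1 := fun n => w n.+1.

End symbolic_space.

Notation Sigma m := (g_sigma_algebraType (@coordinate_sets m)).

Definition is_bernoulli (R : realType) (m : nat) (p : 'I_m.+1 -> R)
    (P : probability (Sigma m) R) : Prop :=
  forall (n : nat) (s : nat -> 'I_m.+1),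
    P [set w | forall j, (j < n)%N -> w j = s j] =
    (\prod_(j < n) p (s j))%:E.

Section semigroup_action.
Context {R : realType} {X : pmetricType R} {m : nat}.
Variable f : 'I_m.+1 -> X -> X.
Implicit Types (w : Sigma m) (k : nat) (x : X) (eps q : R).

Fixpoint orbit_map w k : X -> X :=
  if k is k'.+1 then f (w k') \o orbit_map w k' else idfun.

Definition bowen_dist w k x y : R :=
  \big[Num.max/0]_(i < k) mdist (orbit_map w i x) (orbit_map w i y).

Definition bowen_ball w k x eps : set X :=
  [set y | bowen_dist w k x y <= eps].

Definition skew_product (z : Sigma m * borelType X) : Sigma m * borelType X :=
  (shift z.1, orbit_map z.1 1 z.2).

Section entropies.
Local Open Scope ereal_scope.
Variables (P : probability (Sigma m) R) (mu : probability (borelType X) R).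

Definition full_support : Prop :=
  [set x : X | forall U : set X, open U -> U x -> 0 < mu U] = [set: X].

Definition G_invariant : Prop :=
  forall A : set (Sigma m * borelType X), measurable A ->
    (P \x mu) (skew_product @^-1` A) = (P \x mu) A.

Definition local_entropy w x : \bar R :=
  lim (limn_einf (fun k =>
    - ((k%:R^-1)%:E * lne (mu (bowen_ball w k x eps)))) @[eps --> 0^'+]).

Definition bowen_separated w k eps (E : {fset X}) : Prop :=
  forall x y, x \in E -> y \in E -> x != y -> (eps < bowen_dist w k x y)%R.

(* When X is compact this supremum is a finite maximum. *)
Definition max_separated_card w k eps : \bar R :=
  ereal_sup [set (#|` E|%:R)%:E | E in bowen_separated w k eps].

Definition top_entropy : \bar R :=
  lim (limn_einf (fun k =>
    (k%:R^-1)%:E * \int[P]_w lne (max_separated_card w k eps)) @[eps --> 0^'+]).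

(* Partitions are indexed families. Empty cells of a join do not matter, since
   [0 * lne 0 = 0 * -oo = 0]. *)
Definition shannon_entropy (I : finType) (xi : I -> set X) : \bar R :=
  - \sum_(i : I) mu (xi i) * lne (mu (xi i)).

Definition joint_partition (n : nat) (xi : 'I_n -> set X) w k
    (s : {ffun 'I_k -> 'I_n}) : set X :=
  \bigcap_(i in [set: 'I_k]) (orbit_map w i @^-1` xi (s i)).

Definition partition_entropy (n : nat) (xi : 'I_n -> set X) : \bar R :=
  limn (fun k =>
    (k%:R^-1)%:E * \int[P]_w shannon_entropy (@joint_partition n xi w k)).

Definition measure_entropy : \bar R :=
  ereal_sup [set h | exists n (xi : 'I_n -> set X),
    [/\ forall i, measurable (xi i : set (borelType X)),
        partition [set: 'I_n] xi [set: X] & h = partition_entropy xi]].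

(* Beware that [poweR 0 r = 0] for r < 0. For q < 1 the integrand is the
   intended one when mu charges the Bowen balls, e.g. under [full_support]
   with continuous maps. *)
Definition correlation_sum eps k q : \bar R :=
  if q == 1%R then
    \int[P]_w \int[mu]_x lne (mu (bowen_ball w k x eps))
  else
    ((q - 1)^-1)%:E *
    \int[P]_w lne (\int[mu]_x poweR (mu (bowen_ball w k x eps)) (q - 1)).

Definition upper_correlation_entropy q : \bar R :=
  lim (limn_esup (fun k =>
    - ((k%:R^-1)%:E * correlation_sum eps k q)) @[eps --> 0^'+]).

Definition lower_correlation_entropy q : \bar R :=
  lim (limn_einf (fun k =>
    - ((k%:R^-1)%:E * correlation_sum eps k q)) @[eps --> 0^'+]).

End entropies.
End semigroup_action.

(* Main.v *)
Require Import Defs.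
From HB Require Import structures.
From mathcomp Require Import all_boot all_order all_algebra finmap.
From mathcomp Require Import all_classical all_reals all_analysis.
From mathcomp Require Import measurable_realfun ring lra zify.

Import Order.TTheory GRing.Theory Num.Theory.
Import numFieldNormedType.Exports.

Local Open Scope classical_set_scope.
Local Open Scope ring_scope.

(** Write [B x] for the Bowen ball of the word [w], length [k] and radius [e]
    around [x], and [v x] for its mass. Full support makes [v x] positive.

    Upper bound. Fix [w]. If [E] is a maximal [e/2]-separated set, every [x]
    lies in the [e/2]-ball of some [y] in [E], and this ball is contained in
    [B x]; summing over [y] gives [\int 1 / v <= #|E|]
    ([integral_inv_mass_le]). Up to sign, the correlation sum of order [q < 1]
    is the mean over words of the logarithm of the norm of [1 / v] in [L^s],
    where [s = 1 - q]. By Jensen's inequality this logarithm is at most [ln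
    (\int 1 / v)], hence at most [ln #|E|] ([renyi_info_le]). The upper
    correlation entropy takes a limit superior in [k] and the topological
    entropy a limit inferior. Covering numbers reconcile them: they are
    submultiplicative along orbits, the Bernoulli measure is shift invariant,
    so by Fekete's lemma their mean logarithmic rate has a limit, and
    separated sets are squeezed between covers at two scales
    ([log_sep_rate_esup_einf]).

    Lower bound. Jensen's inequality also shows that the logarithm of the norm
    is smallest for [q = 1], where it is the mean of [- ln v]. By Fatou's
    lemma on the product space the limit inferior of its time average is at
    least the mean of the local entropy at scale [e], and monotone convergence
    as [e] tends to [0] yields the mean of the local entropy, which is at
    least the topological entropy by assumption
    ([top_entropy_le_lower_correlation1]). This settles every [q] in [0, 1]
    ([correlation_entropy_top]).

    Measure entropy. Invariance of the product measure under the skew product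
    means that [mu] is the average of its images under the generators. Entropy
    being concave in the law, the mean entropy of a partition pulled back
    along random orbits does not increase with time
    ([integral_entropy_orbit_le]). This makes the entropy of itineraries
    subadditive, so the limit defining the entropy of a partition exists. If
    the cells have diameter at most [e], points with the same itinerary lie in
    the same Bowen ball, so the entropy of itineraries is at least the mean of
    [- ln v] ([le_measure_entropy]), and the lower bound above applies. For
    the converse inequality a given partition is made locally constant at a
    uniform scale off a set [N] of small measure ([fib_measurable_separated]).
    The itinerary of [x] is then determined by the point of [E] shadowing [x]
    and by the cells met while the orbit is in [N]; the first datum has
    entropy at most [ln #|E|], the second has entropy [o(1)] per unit of time
    as the measure of [N] tends to [0] ([itinerary_rate_le]). *)

(** * Limits inferior, limits superior and subadditivity *)

Section limits.
Local Open Scope ereal_scope.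
Context {R : realType}.
Implicit Types (u v : (\bar R)^nat).

Lemma limn_einfE u : limn_einf u = ereal_sup (range (einfs u)).
Proof. by rewrite limn_einf_lim; apply/cvg_lim => //; exact: cvg_einfs_sup. Qed.

Lemma limn_esupE u : limn_esup u = ereal_inf (range (esups u)).
Proof. by rewrite limn_esup_lim; apply/cvg_lim => //; exact: cvg_esups_inf. Qed.

Lemma le_limn_einf u v : (forall n, u n <= v n) -> limn_einf u <= limn_einf v.
Proof.
move=> uv; rewrite !limn_einf_lim; apply: lee_lim; [exact: is_cvg_einfs..|].
apply: nearW => n; apply: le_ereal_inf_tmp => _ [k nk <-].
by apply: le_trans (uv k); apply: ereal_inf_lbound; exists k.
Qed.

Lemma le_limn_esup u v : (forall n, u n <= v n) -> limn_esup u <= limn_esup v.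
Proof.
move=> uv; rewrite -[leRHS]oppeK -[leLHS]oppeK -!limn_einfN leeN2.
by apply: le_limn_einf => n /=; rewrite leeN2.
Qed.

(** Every entropy at hand is the limit of a monotone function of the scale, that
    is, a supremum over scales: limits can then be compared scale by scale. *)
Lemma lim_at_right0_sup (g : R -> \bar R) :
  (forall a b : R, (0 < a)%R -> (a <= b)%R -> g b <= g a) ->
  lim (g e @[e --> 0%R^'+]) = ereal_sup (g @` [set e | (0 < e)%R]).
Proof.
move=> gmono; apply/cvg_lim => //.
have := @nonincreasing_at_right_cvge _ g 0%R (BInfty _ false) isT.
have -> : [set` Interval (BRight (0:R)%R) +oo%O] = [set e | (0 < e)%R].
  by apply/seteqP; split => x /=; rewrite in_itv/= andbT.
apply => a b; rewrite !in_itv/= !andbT => a0 b0; exact: gmono.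
Qed.

(** Fekete's lemma. Writing [k = q n + r] with [r < n] gives
    [u k <= q * u n + M] with [M] independent of [k], so the limit superior is
    at most [u n / n], for every fixed [n]. *)
Lemma fekete (u : nat -> R) :
  (forall k, (0 <= u k)%R) -> (forall k l, (u (k + l)%N <= u k + u l)%R) ->
  limn_esup (fun k => (k%:R^-1 * u k)%:E) <=
  limn_einf (fun k => (k%:R^-1 * u k)%:E).
Proof.
move=> u0 usub.
have ur r : (u r <= u 0%N + r%:R * u 1%N)%R.
  elim: r => [|r ih]; first by rewrite mul0r addr0.
  rewrite -addn1 natrD mulrDl mul1r addrA; apply: le_trans (usub _ _) _.
  by rewrite lerD2r.
have uq n q r : (u (q * n + r)%N <= q%:R * u n + u r)%R.
  elim: q => [|q ih]; first by rewrite mul0n add0n mul0r add0r.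
  rewrite mulSn -addnA; apply: le_trans (usub _ _) _.
  by rewrite -natr1 mulrDl mul1r (addrC (_ * _)%R) -addrA lerD2l.
have key n : (0 < n)%N ->
    limn_esup (fun k => (k%:R^-1 * u k)%:E) <= (n%:R^-1 * u n)%:E.
  move=> n0; pose M := (u 0%N + n%:R * u 1%N)%R.
  have M0 : (0 <= M)%R by rewrite addr_ge0// mulr_ge0.
  pose v k := (n%:R^-1 * u n + k%:R^-1 * M)%:E.
  have vl : v k @[k --> \oo] --> (n%:R^-1 * u n)%:E.
    apply: cvg_EFin; first exact: nearW.
    rewrite /v /comp /=; rewrite -[X in _ --> X]addr0; apply: cvgD; first exact: cvg_cst.
    rewrite -[X in _ --> X](mul0r M); apply: cvgMr_tmp.
    apply/gtr0_cvgV0.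
      near=> k; rewrite ltr0n; near: k; exact: nbhs_infty_gt.
    exact: cvgr_idn.
  rewrite -(cvg_limn_einf_sup vl).2; apply: le_limn_esup => k.
  rewrite lee_fin.
  have [->|k0] := posnP k; first by rewrite invr0 !mul0r addr0 mulr_ge0 ?invr_ge0.
  rewrite {2}(divn_eq k n) ler_pdivrMl ?ltr0n//.
  apply: le_trans (uq _ _ _) _; rewrite mulrDr mulrA mulVKf ?pnatr_eq0 -?lt0n//.
  rewrite lerD//; last first.
    apply: le_trans (ur _) _; rewrite lerD2l ler_wpM2r// ler_nat ltnW//.
    by rewrite ltn_mod.
  rewrite ler_wpM2r// ler_pdivlMr ?ltr0n// -natrM ler_nat.
  exact: leq_divM.
rewrite [leRHS]limn_einfE; apply: le_trans (ereal_sup_ubound _); last by exists 1%N.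
apply: le_ereal_inf_tmp => _ [k /= k1 <-]; exact: key.
Unshelve. all: by end_near. Qed.

End limits.

(** * Words and the Bernoulli measure *)

Section words.
Context {m : nat}.
Local Notation Sig := (nat -> 'I_m.+1).

(** The quantities attached to a time [k] see only the first letters of a word:
    for such functions measurability and boundedness are automatic. *)
Definition prefix_dep {T : Type} (k : nat) (g : Sig -> T) : Prop :=
  forall w w', (forall i, (i < k)%N -> w i = w' i) -> g w = g w'.

Definition cylinder (k : nat) (s : Sig) : set (Sigma m) :=
  [set w | forall j, (j < k)%N -> w j = s j].

Definition extend_word k (s : {ffun 'I_k -> 'I_m.+1}) : Sig :=
  fun n => oapp s ord0 (insub n).

Definition prefix k (w : Sig) : {ffun 'I_k -> 'I_m.+1} := [ffun i : 'I_k => w i].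

Lemma extend_wordE k (s : {ffun 'I_k -> 'I_m.+1}) (i : 'I_k) :
  extend_word k s i = s i.
Proof. by rewrite /extend_word valK. Qed.

Lemma extend_prefix k w n : (n < k)%N -> extend_word k (prefix k w) n = w n.
Proof. by move=> nk; rewrite -[n]/(nat_of_ord (Ordinal nk)) extend_wordE ffunE. Qed.

Lemma prefix_dep_extend {T : Type} k (g : Sig -> T) w : prefix_dep k g ->
  g (extend_word k (prefix k w)) = g w.
Proof. by apply => i ik; rewrite extend_prefix. Qed.

Lemma prefix_dep_bigcup k (A : set (Sigma m)) : prefix_dep k A ->
  A = \bigcup_(s in [set s | A (extend_word k s)]) cylinder k (extend_word k s).
Proof.
move=> dA; apply/seteqP; split => [w Aw|w [s /= As ws]].
  exists (prefix k w) => /=; first by rewrite (prefix_dep_extend k A).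
  by move=> j jk; rewrite extend_prefix.
by rewrite (dA w (extend_word k s)).
Qed.

Lemma measurable_cylinder k s : measurable (cylinder k s).
Proof.
rewrite (_ : cylinder k s = \bigcap_(i in `I_k) [set w | w i = s i]) //.
apply: bigcap_measurableType => i _; apply: sub_sigma_algebra.
by exists i, (s i).
Qed.

Lemma measurable_prefix_dep k (A : set (Sigma m)) : prefix_dep k A -> measurable A.
Proof.
move=> dA; rewrite (prefix_dep_bigcup _ _ dA).
by apply: fin_bigcup_measurable => // s _; exact: measurable_cylinder.
Qed.

Lemma measurable_fun_prefix_dep d (T : measurableType d) k (g : Sigma m -> T) :
  prefix_dep k g -> measurable_fun setT g.
Proof.
move=> dg _ A mA; rewrite setTI; apply: (measurable_prefix_dep k) => w w' ww'.
by rewrite /preimage /= (dg w w').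
Qed.

Lemma prefix_dep_bounded (R : realType) k (g : Sig -> R) : prefix_dep k g ->
  exists2 M, 0 <= M & forall w, g w <= M.
Proof.
move=> dg; exists (\sum_(s : {ffun 'I_k -> 'I_m.+1}) `|g (extend_word k s)|).
  exact: sumr_ge0.
move=> w; rewrite (bigD1 (prefix k w)) //= (prefix_dep_extend k g)//.
by rewrite (le_trans (ler_norm _))// lerDl sumr_ge0.
Qed.

Definition cons_word (i : 'I_m.+1) (w : Sig) : Sig :=
  fun n => if n is n'.+1 then w n' else i.

Lemma measurable_cons_word i :
  measurable_fun [set: Sigma m] (cons_word i : Sigma m -> Sigma m).
Proof.
apply: (@measurability _ _ (Sigma m) (Sigma m) setT _ (@coordinate_sets m)) => //.
move=> _ [_ [n [j ->] <-]]; rewrite setTI; apply: (measurable_prefix_dep n).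
by move=> w w' ww'; rewrite /preimage/=; case: n ww' => //= n ->.
Qed.

Lemma measurable_shift : measurable_fun [set: Sigma m] (@Defs.shift m : Sigma m -> Sigma m).
Proof.
apply: (@measurability _ _ (Sigma m) (Sigma m) setT _ (@coordinate_sets m)) => //.
move=> _ [_ [n [j ->] <-]]; rewrite setTI; apply: (measurable_prefix_dep n.+2).
by move=> w w' ww'; rewrite /preimage/= /Defs.shift ww'.
Qed.

End words.

Section bernoulli.
Context {R : realType} {m : nat} {p : 'I_m.+1 -> R} {P : probability (Sigma m) R}.
Hypotheses (p_gt0 : forall i, 0 < p i) (sum_p : \sum_i p i = 1).
Hypothesis bernP : is_bernoulli p P.
Local Open Scope ereal_scope.

Let cons_part (n : nat) : {measure set (Sigma m) -> \bar R}.
Proof.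
refine (mscale (NngNum (ltW (p_gt0 (inord n))))
  (pushforward P (cons_word (inord n) : Sigma m -> Sigma m))).
exact: measurable_cons_word.
Defined.

Let consP : {measure set (Sigma m) -> \bar R} := msum cons_part m.+1.

Let consPE A : consP A = \sum_i (p i)%:E * P (cons_word i @^-1` A).
Proof.
rewrite /consP/= /msum; apply: eq_bigr => i _.
by rewrite /cons_part/= /mscale/= /pushforward inord_val.
Qed.

Let consP_cylinder k s : consP (cylinder k s) = P (cylinder k s).
Proof.
rewrite consPE [RHS](bernP k s); case: k => [|k].
  rewrite big_ord0 -sum_p -sumEFin; apply: eq_bigr => i _.
  rewrite (_ : _ @^-1` _ = setT) ?probability_setT ?mule1//.
  by apply/seteqP; split.
rewrite big_ord_recl (bigD1 (s 0%N))//= big1 => [|i is0].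
  rewrite adde0 EFinM; congr (_ * _).
  rewrite -(bernP k (fun n => s n.+1)); congr (P _).
  apply/seteqP; split => w /= h j jk; first exact: (h j.+1).
  by case: j jk => //= j jk; exact: h.
rewrite (_ : _ @^-1` _ = set0) ?measure0 ?mule0//.
by apply/seteqP; split => // w /(_ 0%N isT) /= is0'; move: is0; rewrite is0' eqxx.
Qed.

(** Both sides are measures that agree on cylinders, hence on the sets that
    depend on finitely many letters; these are a generating pi-system. *)
Lemma bernoulli_cons A : measurable A ->
  P A = \sum_i (p i)%:E * P (cons_word i @^-1` A).
Proof.
move=> mA; rewrite -consPE.
apply: (@measure_unique _ R (Sigma m) [set A | exists k, prefix_dep k A] (fun=> setT)) => //.
- apply/seteqP; split => B mB.
    move: B mB; apply: smallest_sub; first exact: smallest_sigma_algebra.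
    move=> _ [n [j ->]]; apply: sub_sigma_algebra; exists n.+1 => w w' ww' /=.
    by rewrite ww'.
  move: B mB; apply: smallest_sub; first exact: sigma_algebra_measurable.
  by move=> B [k dB]; exact: measurable_prefix_dep dB.
- move=> B C [k dB] [l dC]; exists (maxn k l) => w w' ww'; rewrite /setI /=.
  congr and; [apply: dB|apply: dC] => i il; apply: ww'; lia.
- by move=> _; exists 0%N.
- by rewrite bigcup_const.
- move=> B [k dB]; rewrite (prefix_dep_bigcup k B dB).
  have tr : trivIset [set s | B (extend_word k s)]
      (fun s => cylinder k (extend_word k s)).
    move=> s s' _ _ [w [ws ws']]; apply/ffunP => i.
    by rewrite -(extend_wordE k s) -(extend_wordE k s') -ws// -ws'.
  have mc s : measurable (cylinder k (extend_word k s)) := measurable_cylinder _ _.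
  rewrite !measure_fin_bigcup//; try exact: finite_finset.
  by apply: eq_fsbigr => s _; exact/esym/consP_cylinder.
- by move=> _ /=; apply: le_lt_trans (probability_le1 P measurableT) (ltry _).
Qed.

(** The first letter is independent of the remaining word, whose law is again
    [P]. *)
Lemma integral_bernoulli_cons (g : Sigma m -> \bar R) :
  measurable_fun setT g -> (forall w, 0 <= g w) ->
  \int[P]_w g w = \sum_i (p i)%:E * \int[P]_w g (cons_word i w).
Proof.
move=> mg g0.
have -> : \int[P]_w g w = \int[consP]_w g w.
  by apply: eq_measure_integral => A mA _; rewrite consPE -bernoulli_cons.
rewrite ge0_integral_measure_sum//; apply: eq_bigr => i _.
rewrite /cons_part ge0_integral_mscale//= inord_val; congr (_ * _).
rewrite (ge0_integral_pushforward (measurable_cons_word i) P)//.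
Qed.

Lemma integral_shift (g : Sigma m -> \bar R) :
  measurable_fun setT g -> (forall w, 0 <= g w) ->
  \int[P]_w g (Defs.shift w) = \int[P]_w g w.
Proof.
move=> mg g0; rewrite integral_bernoulli_cons//; last first.
  exact: measurableT_comp measurable_shift.
transitivity (\sum_i (p i)%:E * \int[P]_w g w).
  by apply: eq_bigr => i _.
rewrite -ge0_sume_distrl; last by move=> i _; rewrite lee_fin ltW.
by rewrite sumEFin sum_p mul1e.
Qed.

End bernoulli.

(** * Bowen metrics, separated sets and covers *)

Section bowen.
Context {R : realType} {X : pmetricType R} {m : nat}.
Variable f : 'I_m.+1 -> X -> X.
Implicit Types (w : nat -> 'I_m.+1) (k l : nat) (e : R) (x y z : X).

Local Notation dist := (bowen_dist f).
Local Notation bball := (bowen_ball f).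

Lemma orbit_mapD w k l x :
  orbit_map f w (k + l) x = orbit_map f (iter k (@Defs.shift m) w) l (orbit_map f w k x).
Proof.
have iterE : forall n i, iter n (@Defs.shift m) w i = w (n + i)%N.
  by elim=> // n ih i; rewrite iterS /Defs.shift ih addnS.
elim: l => [|l ih]; first by rewrite addn0.
by rewrite addnS /= ih iterE.
Qed.

Lemma orbit_map_cons i w k x :
  orbit_map f (cons_word i w) k.+1 x = orbit_map f w k (f i x).
Proof. by rewrite -[k.+1]/(1 + k)%N orbit_mapD. Qed.

Lemma prefix_dep_orbit_map k i : (i <= k)%N ->
  prefix_dep k (fun w => orbit_map f w i).
Proof.
elim: i => [//|i ih] ik w w' ww' /=; rewrite ww'//.
by rewrite (ih (ltnW ik) w w').
Qed.

Lemma bowen_distP w k x y e : 0 <= e ->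
  (dist w k x y <= e) <->
  (forall i, (i < k)%N -> mdist (orbit_map f w i x) (orbit_map f w i y) <= e).
Proof.
move=> e0; split => [/bigmax_leP[_ h] i ik|h].
  exact: (h (Ordinal ik)).
by apply/bigmax_leP; split => // i _; exact: h.
Qed.

Lemma bowen_dist_ge0 w k x y : 0 <= dist w k x y.
Proof. by have /bigmax_leP[] := lexx (dist w k x y). Qed.

Lemma le_bowen_dist w k x y i : (i < k)%N ->
  mdist (orbit_map f w i x) (orbit_map f w i y) <= dist w k x y.
Proof. by move=> ik; apply: ((bowen_distP w k x y _ (bowen_dist_ge0 _ _ _ _)).1 _ i). Qed.

Lemma bowen_distxx w k x : dist w k x x = 0.
Proof.
apply/eqP; rewrite eq_le bowen_dist_ge0 andbT; apply/bowen_distP => // i _.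
by rewrite mdistxx.
Qed.

Lemma bowen_dist_sym w k x y : dist w k x y = dist w k y x.
Proof. by rewrite /bowen_dist; apply: eq_bigr => i _; rewrite metric_sym. Qed.

Lemma bowen_dist_triangle w k x y z : dist w k x z <= dist w k x y + dist w k y z.
Proof.
apply/bowen_distP => [|i ik]; first by rewrite addr_ge0 ?bowen_dist_ge0.
by rewrite (le_trans (metric_triangle _ (orbit_map f w i y) _))// lerD// le_bowen_dist.
Qed.

Lemma prefix_dep_bowen_dist k : prefix_dep k (fun w => dist w k).
Proof.
move=> w w' ww'; apply/funext => x; apply/funext => y.
apply: eq_bigr => i _; rewrite (prefix_dep_orbit_map k i (ltnW (ltn_ord i)) w w')//.
Qed.

Lemma prefix_dep_bowen_ball k : prefix_dep k (fun w => bball w k).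
Proof.
move=> w w' ww'; apply/funext => x; apply/funext => e.
by rewrite /bowen_ball (prefix_dep_bowen_dist k w w').
Qed.

Lemma bowen_dist_cat w k l x y e : 0 <= e ->
  dist w k x y <= e ->
  dist (iter k (@Defs.shift m) w) l (orbit_map f w k x) (orbit_map f w k y) <= e ->
  dist w (k + l) x y <= e.
Proof.
move=> e0 /bowen_distP h1 /bowen_distP h2; apply/bowen_distP => // i ikl.
have [ik|ki] := ltnP i k; first exact: h1.
by rewrite -(subnKC ki) !orbit_mapD; apply: h2 => //; lia.
Qed.

Hypothesis contf : forall i, continuous (f i).

Lemma continuous_orbit_map w k : continuous (orbit_map f w k : X -> X).
Proof.
elim: k => [|k ih] x; first exact: cvg_id.
exact: (continuous_comp (ih x) (contf _ _)).
Qed.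

Lemma nbhs_bowen_ball w k x e : 0 < e -> nbhs x (bball w k x e).
Proof.
move=> e0.
have : \forall y \near x, forall i : 'I_k,
    ball (orbit_map f w i x) e (orbit_map f w i y).
  apply: filter_forall => i; apply: (continuous_orbit_map w i x).
  exact: nbhsx_ballx.
apply: filterS => y h; apply/bowen_distP; first exact: ltW.
move=> i ik; have := h (Ordinal ik).
by rewrite ballEmdist /= => /ltW.
Qed.

(** The Bowen metric is topologically equivalent to the original one: its balls
    are neighbourhoods, so they may be used to test openness. *)
Lemma open_bowen w k (A : set X) :
  (forall x, A x -> exists2 e, 0 < e & bball w k x e `<=` A) -> open A.
Proof.
move=> h; rewrite openE => x /h[e e0 sA]; apply: filterS sA _.
exact: nbhs_bowen_ball.
Qed.

Lemma measurable_bowen_ball w k x e :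
  measurable (bball w k x e : set (borelType X)).
Proof.
rewrite -[X in measurable X]setCK; apply: measurableC; apply: sub_sigma_algebra.
apply: (open_bowen w k) => y /negP; rewrite -ltNge => ey.
exists ((dist w k x y - e) / 2); first by rewrite divr_gt0// subr_gt0.
move=> z /= yz; apply/negP; rewrite -ltNge.
have := bowen_dist_triangle w k x z y; rewrite (bowen_dist_sym _ _ z y).
move: yz; rewrite /bowen_ball/= => yz; lra.
Qed.

Hypothesis compX : compact [set: X].

Lemma bowen_net w k e : 0 < e ->
  exists F : {fset X}, forall y, exists2 x, x \in F & dist w k x y <= e.
Proof.
move=> e0; have := compX; rewrite compact_cover => cX.
have [x _|x _|F _ FX] := cX X setT (fun x => (bball w k x e)°).
- exact: open_interior.
- by exists x => //; exact: nbhs_bowen_ball.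
exists F => y; have [x /= xF xy] := FX y I.
by exists x => //; exact: interior_subset xy.
Qed.

(** A cover by [N] sets of diameter at most [e], as the colour classes of an
    arbitrary map to [N] colours: covers of two consecutive time blocks are then
    combined by pairing colours. *)
Definition coverable w k e (N : nat) : Prop := exists (T : finType) (c : X -> T),
  #|T| = N /\ forall x y, c x = c y -> dist w k x y <= e.

Lemma coverable_net w k e (F : {fset X}) :
  (forall y, exists2 x, x \in F & dist w k x y <= e) ->
  coverable w k (e + e) #|` F|.
Proof.
move=> /(_ _)/cid2 h; exists F, (fun y => [` s2valP (h y)]%fset); split.
  by rewrite cardfE.
move=> x y [] xy; apply: le_trans (bowen_dist_triangle _ _ _ (s2val (h x)) _) _.
by rewrite lerD// ?[dist _ _ x _]bowen_dist_sym ?(s2valP' (h x))// xy (s2valP' (h y)).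
Qed.

Lemma separated_coverable w k e N (E : {fset X}) :
  bowen_separated f w k e E -> coverable w k e N -> (#|` E| <= N)%N.
Proof.
move=> sE [T [c [<- cd]]]; rewrite cardfE.
rewrite -(@card_imset _ _ (fun x : E => c (val x))) ?max_card//.
move=> x y cxy; apply/val_inj/eqP/contraT => xy.
by have := sE _ _ (valP x) (valP y) xy; rewrite ltNge cd.
Qed.

Lemma coverableM w k l e a b : 0 <= e ->
  coverable w k e a -> coverable (iter k (@Defs.shift m) w) l e b ->
  coverable w (k + l) e (a * b).
Proof.
move=> e0 [S [c [<- cd]]] [T [c' [<- cd']]].
exists (S * T)%type, (fun x => (c x, c' (orbit_map f w k x))); split.
  by rewrite card_prod.
by move=> x y [/cd ? /cd' ?]; exact: bowen_dist_cat.
Qed.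

Lemma coverable_gt0 w k e N : coverable w k e N -> (0 < N)%N.
Proof. by move=> [T [c [<- _]]]; apply/card_gt0P; exists (c point). Qed.

(** Compactness bounds the size of a separated set, so a largest one exists;
    a point at distance more than [e] from all of it could be added, so it is
    also a net. *)
Lemma maximal_separated w k e : 0 < e ->
  exists E : {fset X}, [/\ bowen_separated f w k e E,
    max_separated_card f w k e = (#|` E|%:R)%:E, (0 < #|` E|)%N &
    forall y, exists2 x, x \in E & dist w k x y <= e].
Proof.
move=> e0.
pose Q n := `[< exists2 E : {fset X}, bowen_separated f w k e E & #|` E| = n >].
have Q0 : exists n, Q n.
  by exists 0%N; apply/asboolP; exists fset0 => [x y|]; rewrite ?inE.
have [F Fnet] := bowen_net w k (e / 2) (divr_gt0 e0 (ltr0Sn _ 1)).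
have Qle n : Q n -> (n <= #|` F|)%N.
  move=> /asboolP[E sE <-]; apply: separated_coverable sE _.
  by rewrite [e]splitr; exact: coverable_net.
case: (ex_maxnP Q0 Qle) => N /asboolP[E sE EN] Nmax.
have net y : exists2 x, x \in E & dist w k x y <= e.
  apply: contrapT => /forall2NP h.
  have h' x : x \in E -> e < dist w k x y.
    by move=> xE; have [//|/negP] := h x; rewrite -ltNge.
  have yE : y \notin E.
    by apply/negP => /h'; rewrite bowen_distxx ltNge ltW.
  have : (#|` (y |` E)%fset| <= N)%N.
    apply: Nmax; apply/asboolP; exists (y |` E)%fset => // a b.
    rewrite !inE => /orP[/eqP->|aE] /orP[/eqP->|bE]; rewrite ?eqxx//.
    - by move=> _; rewrite bowen_dist_sym; exact: h'.
    - by move=> _; exact: h'.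
    - exact: sE.
  by rewrite cardfsU1 yE EN add1n ltnn.
exists E; split => //.
- apply/eqP; rewrite eq_le; apply/andP; split.
    apply: ge_ereal_sup => _ [E' sE' <-]; rewrite lee_fin ler_nat EN.
    by apply: Nmax; apply/asboolP; exists E'.
  by apply: ereal_sup_ubound; exists E.
- have [x xE _] := net point; rewrite cardfs_gt0; apply/negP => /eqP E0.
  by move: xE; rewrite E0 inE.
Qed.

End bowen.

(** * Jensen's inequality *)

Section jensen.
Local Open Scope ereal_scope.
Context {d} {T : measurableType d} {R : realType} {mu : probability T R}.
Implicit Types g : T -> R.

Lemma integral_probability_cst (c : \bar R) : \int[mu]_x (cst c x) = c.
Proof. by rewrite integral_cst//= probability_setT mule1. Qed.

Lemma powR_le_affine (t s : R) : (0 <= t -> 0 < s <= 1 -> t `^ s <= s * t + (1 - s))%R.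
Proof.
move=> t0 /andP[s0]; rewrite le_eqVlt => /predU1P[->|s1].
  by rewrite powRr1// mul1r subrr addr0.
have s1' : (0 < 1 - s)%R by rewrite subr_gt0.
have := @conjugate_powR R (t `^ s)%R 1%R s^-1%R (1 - s)^-1%R (powR_ge0 _ _) ler01.
rewrite !invr_gt0 s0 s1' !invrK mulr1 subrKC powR1 mul1r => /(_ isT isT erefl).
by rewrite -powRrM mulfV ?gt_eqF// powRr1// mulrC.
Qed.

Section bounded_below.
Variable g : T -> R.
Hypotheses (mg : measurable_fun setT g) (g1 : forall x, (1 <= g x)%R).
Hypothesis gfin : \int[mu]_x (g x)%:E < +oo.

Let M := fine (\int[mu]_x (g x)%:E).

Let mZg (k : R) : measurable_fun setT (fun x => k%:E * (g x)%:E).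
Proof. by apply/measurable_EFinP; exact: measurable_funM. Qed.

Let integral_ge1 : 1 <= \int[mu]_x (g x)%:E.
Proof.
apply: (@le_trans _ _ (\int[mu]_x (cst 1 x))).
  by rewrite integral_probability_cst.
apply: ge0_le_integral => //; [exact/measurable_EFinP|].
by move=> x _; rewrite lee_fin.
Qed.

Let ME : \int[mu]_x (g x)%:E = M%:E.
Proof. by rewrite fineK// ge0_fin_numE// (le_trans _ integral_ge1)// lee_fin. Qed.

Let M1 : (1 <= M)%R. Proof. by rewrite -lee_fin -ME. Qed.

Let M0 : (0 < M)%R. Proof. exact: lt_le_trans M1. Qed.

(** Integrate the tangent line of [ln] at the mean,
    [ln g <= ln M + g / M - 1]. *)
Lemma jensen_ln : \int[mu]_x (ln (g x))%:E <= lne (\int[mu]_x (g x)%:E).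
Proof.
have g0 x : (0 < g x)%R by exact: lt_le_trans (g1 x).
rewrite ME lne_EFin// -(@leeD2rE _ 1)//.
have mlng : measurable_fun setT (fun x => (ln (g x))%:E).
  by apply/measurable_EFinP; exact: measurableT_comp.
apply: (@le_trans _ _ (\int[mu]_x ((ln (g x))%:E + cst 1 x))).
  rewrite ge0_integralD//=.
    by rewrite integral_probability_cst.
  by move=> x _; rewrite lee_fin ln_ge0.
apply: (@le_trans _ _ (\int[mu]_x (cst (ln M)%:E x + M^-1%:E * (g x)%:E))).
  apply: ge0_le_integral => //.
  - by move=> x _; rewrite adde_ge0// ?lee_fin ?ln_ge0.
  - exact: emeasurable_funD.
  - apply: emeasurable_funD => //; exact: mZg.
  - move=> x _ /=; rewrite -EFinM -!EFinD lee_fin.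
    have := @le_ln1Dx R (M^-1 * g x - 1).
    rewrite subrKC lnM ?posrE ?invr_gt0// lnV ?posrE// => h.
    have : (-1 < M^-1 * g x - 1)%R by rewrite ltrBDl subrr mulr_gt0 ?invr_gt0.
    by move=> /h; lra.
rewrite ge0_integralD//=.
- rewrite integral_probability_cst ge0_integralZl//.
  + by rewrite ME -EFinM mulVf// gt_eqF.
  + exact/measurable_EFinP.
  + by move=> x _; rewrite lee_fin ltW.
  + by rewrite lee_fin invr_ge0 ltW.
- by move=> x _; rewrite lee_fin ln_ge0.
- by move=> x _; rewrite -EFinM lee_fin mulr_ge0 ?invr_ge0// ltW.
Qed.

(** Integrate the tangent line of the power at the mean,
    [(g / M) `^ s <= s * (g / M) + (1 - s)]. *)
Lemma jensen_powR (s : R) : (0 < s <= 1)%R ->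
  \int[mu]_x (g x `^ s)%:E <= (M `^ s)%:E.
Proof.
move=> s01; have /andP[s0 s1] := s01.
have g0 x : (0 <= g x)%R by exact: le_trans (g1 x).
apply: (@le_trans _ _ (\int[mu]_x
  ((M `^ s * (s * M^-1))%:E * (g x)%:E + cst (M `^ s * (1 - s))%:E x))).
  apply: ge0_le_integral => //.
  - by move=> x _; rewrite lee_fin powR_ge0.
  - by apply/measurable_EFinP; exact: (measurableT_comp (measurable_powR _) mg).
  - apply: emeasurable_funD => //; exact: mZg.
  - move=> x _; rewrite /= -EFinM -EFinD lee_fin -mulrA -mulrDr.
    rewrite -{1}(mulVKf (lt0r_neq0 M0) (g x)) powRM ?(ltW M0)//; last first.
      by rewrite mulr_ge0// invr_ge0 ltW.
    rewrite ler_wpM2l ?powR_ge0// -mulrA; apply: powR_le_affine => //.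
    by rewrite mulr_ge0// invr_ge0 ltW.
have c1 : (0 <= M `^ s * (s * M^-1))%R.
  by rewrite mulr_ge0 ?powR_ge0// mulr_ge0 ?ltW// invr_gt0.
have c2 : (0 <= M `^ s * (1 - s))%R by rewrite mulr_ge0 ?powR_ge0// subr_ge0.
rewrite ge0_integralD//=.
- rewrite integral_probability_cst ge0_integralZl//.
  + rewrite ME [leRHS](_ : _ =
      (M `^ s * (s * M^-1) * M + M `^ s * (1 - s))%:E)//.
    by congr EFin; rewrite -2!mulrA mulVf ?gt_eqF//; ring.
  + exact/measurable_EFinP.
  + by move=> x _; rewrite lee_fin.
- by move=> x _; rewrite -EFinM lee_fin mulr_ge0.
Qed.

End bounded_below.
End jensen.

(** * Masses of Bowen balls *)

(** A cylinder decomposition reduces joint measurability to finitely many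
    functions of the second variable. *)
Lemma measurable_prefix_dep_prod {m : nat} {d d'} {T : measurableType d}
    {U : measurableType d'} k (g : Sigma m -> T -> U) :
  prefix_dep k g -> (forall w, measurable_fun setT (g w)) ->
  measurable_fun [set: Sigma m * T] (fun z => g z.1 z.2).
Proof.
move=> dg mg _ A mA; rewrite setTI.
have -> : (fun z : Sigma m * T => g z.1 z.2) @^-1` A =
  \bigcup_(s in [set: {ffun 'I_k -> 'I_m.+1}])
    (cylinder k (extend_word k s) `*` (g (extend_word k s) @^-1` A)).
  apply/seteqP; split => [[w x] /= Ax|[w x] [s _ [/= ws]]].
    exists (prefix k w) => //; split => /=.
      by move=> j jk; rewrite extend_prefix.
    by rewrite /= (prefix_dep_extend k g).
  by rewrite /= (dg w (extend_word k s)).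
apply: fin_bigcup_measurable; first exact: finite_finset.
move=> s _; apply: measurableX; first exact: measurable_cylinder.
by rewrite -[X in measurable X]setTI; exact: mg.
Qed.

Section ball_mass.
Context {R : realType} {X : pmetricType R} {m : nat}.
Variables (f : 'I_m.+1 -> X -> X) (mu : probability (borelType X) R).
Hypothesis contf : forall i, continuous (f i).
Hypothesis suppmu : full_support mu.
Implicit Types (w : Sigma m) (k : nat) (e : R) (x : X).
Local Open Scope ereal_scope.

Definition ball_mass w k e x : R := fine (mu (bowen_ball f w k x e)).

Lemma ball_massE w k e x : mu (bowen_ball f w k x e) = (ball_mass w k e x)%:E.
Proof. by rewrite fineK// fin_num_measure//; exact: measurable_bowen_ball. Qed.

Lemma ball_mass_gt0 w k e x : (0 < e)%R -> (0 < ball_mass w k e x)%R.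
Proof.
move=> e0; rewrite -lte_fin -ball_massE.
have : [set: X] x by [].
rewrite -suppmu => /(_ (bowen_ball f w k x e)°) h.
apply: (lt_le_trans (h (@open_interior _ _) (nbhs_bowen_ball _ contf w k x e e0))).
apply: le_measure; rewrite ?inE.
- by apply: sub_sigma_algebra; exact: open_interior.
- exact: measurable_bowen_ball.
- exact: interior_subset.
Qed.

Lemma ball_mass_le1 w k e x : (ball_mass w k e x <= 1)%R.
Proof.
by rewrite -lee_fin -ball_massE; apply: probability_le1; exact: measurable_bowen_ball.
Qed.

Lemma le_ball_mass w k e e' x : (e <= e')%R ->
  (ball_mass w k e x <= ball_mass w k e' x)%R.
Proof.
move=> ee'; rewrite -lee_fin -!ball_massE; apply: le_measure; rewrite ?inE.
- exact: measurable_bowen_ball.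
- exact: measurable_bowen_ball.
- by move=> y /le_trans; exact.
Qed.

Lemma prefix_dep_ball_mass k : prefix_dep k (fun w => ball_mass w k).
Proof.
move=> w w' ww'; apply/funext => e; apply/funext => x.
by rewrite /ball_mass (prefix_dep_bowen_ball f k w w').
Qed.

(** The mass of a closed ball is upper semicontinuous in its centre: slightly
    larger concentric balls have nearly the same mass and contain the balls with
    nearby centres. *)
Lemma measurable_ball_mass w k e :
  measurable_fun [set: borelType X] (ball_mass w k e).
Proof.
apply: (@measurability _ _ (borelType X) _ setT _ _ (RGenInftyO.measurableE R)).
move=> /= _ [_ [a ->] <-]; rewrite setTI; apply: sub_sigma_algebra.
apply: (open_bowen f contf w k) => x /=; rewrite in_itv/= => xa.
pose B n := bowen_ball f w k x (e + n.+1%:R^-1).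
have mB n : measurable (B n : set (borelType X)) by exact: measurable_bowen_ball.
have capB : \bigcap_n B n = bowen_ball f w k x e.
  apply/seteqP; split => y /= yB.
    apply/ler_addgt0Pl => d d0; rewrite addrC.
    have [n _ nd] := near_infty_natSinv_lt (PosNum d0).
    by apply: (le_trans (yB n I)); rewrite lerD2l ltW//; exact: (nd n (leqnn n)).
  by move=> n _; rewrite /B/bowen_ball/=; apply: (le_trans yB); rewrite lerDl.
have : mu \o B @ \oo --> mu (\bigcap_n B n).
  apply: nonincreasing_cvg_mu => //.
  - by apply: le_lt_trans (probability_le1 _ (mB 0%N)) (ltry _).
  - by apply: bigcapT_measurable.
  - move=> i j ij; apply/subsetPset => y /le_trans; apply.
    by rewrite lerD2l lef_pV2 ?posrE// ler_nat.
rewrite capB ball_massE => /fine_cvgP[_ /cvgr_lt /(_ _ xa)][n _ /(_ n (leqnn n))/= Bna].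
exists n.+1%:R^-1%R => // y xy /=; rewrite in_itv/=; apply: le_lt_trans Bna.
rewrite fine_le ?fin_num_measure//; first exact: measurable_bowen_ball.
apply: le_measure; rewrite ?inE //; first exact: measurable_bowen_ball.
move=> z yz; apply: (le_trans (bowen_dist_triangle f w k x y z)).
by rewrite addrC lerD.
Qed.

(** [ln (inv_mass w k e x)] is the information of the ball around [x]; working
    with the inverse mass keeps every integrand nonnegative. *)
Definition inv_mass w k e x : R := (ball_mass w k e x)^-1.

Lemma inv_mass_ge1 w k e x : (0 < e)%R -> (1 <= inv_mass w k e x)%R.
Proof. by move=> e0; rewrite invf_ge1 ?ball_mass_gt0// ball_mass_le1. Qed.

Lemma inv_mass_gt0 w k e x : (0 < e)%R -> (0 < inv_mass w k e x)%R.
Proof. by move=> e0; rewrite invr_gt0 ball_mass_gt0. Qed.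

Lemma measurable_inv_mass w k e : (0 < e)%R ->
  measurable_fun [set: borelType X] (inv_mass w k e).
Proof.
move=> e0; rewrite (_ : inv_mass w k e = (fun x => ball_mass w k e x `^ (-1))%R).
  exact: (measurableT_comp (measurable_powR _) (measurable_ball_mass w k e)).
by apply/funext => x; rewrite powR_inv1// ltW// ball_mass_gt0.
Qed.

(** If [x] lies in the [e]-ball [B y] then the [2 e]-ball around [x] contains
    [B y]. So its inverse mass is at most the sum, over the points [y] of the
    net, of [1_(B y) x / mu (B y)], and each term has integral one. *)
Lemma integral_inv_mass_le w k e (E : {fset X}) : (0 < e)%R ->
  (forall y, exists2 x, x \in E & (bowen_dist f w k x y <= e)%R) ->
  \int[mu]_x (inv_mass w k (e + e) x)%:E <= (#|` E|%:R)%:E.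
Proof.
move=> e0 net.
pose B x : set (borelType X) := bowen_ball f w k x e.
have mB x : measurable (B x) by exact: measurable_bowen_ball.
have mZ y : measurable_fun [set: borelType X]
    (fun x => (inv_mass w k e y)%:E * (\1_(B y) x)%:E).
  by apply/measurable_EFinP; apply: measurable_funM => //.
have c0 y : (0 <= inv_mass w k e y)%R by rewrite (le_trans _ (inv_mass_ge1 _ _ _ _ e0)).
apply: (@le_trans _ _ (\int[mu]_x
  (\sum_(y <- E) (inv_mass w k e y)%:E * (\1_(B y) x)%:E))).
  apply: ge0_le_integral => //.
  - by move=> x _; rewrite lee_fin (le_trans _ (inv_mass_ge1 _ _ _ _ _))// addr_gt0.
  - by apply/measurable_EFinP; apply: measurable_inv_mass; rewrite addr_gt0.
  - exact: emeasurable_sum.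
  - move=> x _; have [y yE yx] := net x.
    rewrite (big_rem y)//= indicE mem_set// mule1.
    apply: (@le_trans _ _ (inv_mass w k e y)%:E); last first.
      by rewrite leeDl// sume_ge0// => z _; rewrite -EFinM lee_fin mulr_ge0.
    rewrite lee_fin lef_pV2 ?posrE ?ball_mass_gt0 ?addr_gt0//.
    rewrite -lee_fin -!ball_massE; apply: le_measure; rewrite ?inE;
      [exact: measurable_bowen_ball|exact: measurable_bowen_ball|].
    move=> z yz; rewrite /bowen_ball/=.
    by rewrite (le_trans (bowen_dist_triangle f w k x y z))// lerD// bowen_dist_sym.
rewrite ge0_integral_sum//; last first.
  by move=> y x _; rewrite -EFinM lee_fin mulr_ge0.
rewrite (eq_bigr (fun=> 1)) => [|y _].
  by rewrite sumEFin big_const_seq count_predT iter_addr_0.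
rewrite ge0_integralZl//; [|exact/measurable_EFinP|by rewrite lee_fin].
rewrite integral_indic//= setIT ball_massE -EFinM mulVf// gt_eqF//.
exact: ball_mass_gt0.
Qed.

End ball_mass.

(** * Topological entropy *)

Section prefix_integral.
Context {R : realType} {m : nat} {p : 'I_m.+1 -> R} {P : probability (Sigma m) R}.
Local Open Scope ereal_scope.

Lemma integral_prefix_dep_fin k (g : Sigma m -> R) :
  prefix_dep k g -> (forall w, 0 <= g w)%R -> \int[P]_w (g w)%:E \is a fin_num.
Proof.
move=> dg g0; rewrite ge0_fin_numE; last first.
  by apply: integral_ge0 => w _; rewrite lee_fin.
have [M M0 gM] := prefix_dep_bounded R k g dg.
apply: (@le_lt_trans _ _ (\int[P]_w (cst M%:E w))); last first.
  by rewrite integral_probability_cst ltry.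
apply: ge0_le_integral => //.
- by move=> w _; rewrite lee_fin.
- by apply/measurable_EFinP; exact: (measurable_fun_prefix_dep _ _ k).
- by move=> w _; rewrite lee_fin.
Qed.

Lemma fekete_integral (a : nat -> Sigma m -> R) :
  (forall k, prefix_dep k (a k)) -> (forall k w, 0 <= a k w)%R ->
  (forall k l, \int[P]_w (a (k + l)%N w)%:E <=
    \int[P]_w (a k w)%:E + \int[P]_w (a l w)%:E) ->
  limn_esup (fun k => (k%:R^-1)%:E * \int[P]_w (a k w)%:E) <=
  limn_einf (fun k => (k%:R^-1)%:E * \int[P]_w (a k w)%:E).
Proof.
move=> da a0 asub.
have aE k : \int[P]_w (a k w)%:E = (fine (\int[P]_w (a k w)%:E))%:E.
  by rewrite fineK//; exact: integral_prefix_dep_fin (da k) (a0 k).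
rewrite (_ : (fun k => _) =
  (fun k => (k%:R^-1 * fine (\int[P]_w (a k w)%:E))%:E)); last first.
  by apply/funext => k; rewrite aE.
apply: fekete => [k|k l].
  by apply: fine_ge0; apply: integral_ge0 => w _; rewrite lee_fin.
by rewrite -lee_fin EFinD -!aE.
Qed.

Hypotheses (p_gt0 : forall i, (0 < p i)%R) (sum_p : (\sum_i p i = 1)%R).
Hypothesis bernP : is_bernoulli p P.

Lemma integral_iter_shift k (g : Sigma m -> \bar R) :
  measurable_fun setT g -> (forall w, 0 <= g w) ->
  \int[P]_w g (iter k (@Defs.shift m) w) = \int[P]_w g w.
Proof.
elim: k g => [//|k ih] g mg g0.
rewrite -[RHS](integral_shift p_gt0 sum_p bernP)//.
apply: (ih (fun w => g (Defs.shift w))) => //.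
exact: measurableT_comp mg measurable_shift.
Qed.

End prefix_integral.

Lemma iter_shiftE {m} k (w : nat -> 'I_m.+1) n :
  iter k (@Defs.shift m) w n = w (k + n)%N.
Proof. by elim: k n => // k ih n; rewrite iterS /Defs.shift ih addnS. Qed.

Lemma prefix_dep_iter_shift {m} {T : Type} k l (g : (nat -> 'I_m.+1) -> T) :
  prefix_dep l g -> prefix_dep (k + l) (fun w => g (iter k (@Defs.shift m) w)).
Proof.
move=> dg w w' ww'; apply: dg => i il; rewrite !iter_shiftE ww'//.
by rewrite ltn_add2l.
Qed.

Section covering_numbers.
Context {R : realType} {X : pmetricType R} {m : nat}.
Variable (f : 'I_m.+1 -> X -> X).
Hypotheses (compX : compact [set: X]) (contf : forall i, continuous (f i)).
Implicit Types (w : nat -> 'I_m.+1) (k l : nat) (e : R).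

(** The least size of a cover; the default value is never taken at positive
    scales. *)
Definition cover_num w k e : nat :=
  xget 0%N [set N | coverable f w k e N /\
                    forall N', coverable f w k e N' -> (N <= N')%N].

Lemma cover_numP w k e : 0 < e -> coverable f w k e (cover_num w k e) /\
  forall N, coverable f w k e N -> (cover_num w k e <= N)%N.
Proof.
move=> e0; rewrite /cover_num.
case: xgetP => [N _ //|h].
have [F Fnet] := bowen_net f contf compX w k (e / 2) (divr_gt0 e0 (ltr0Sn _ 1)).
have cF := coverable_net f w k _ F Fnet.
have Q0 : exists N, `[< coverable f w k e N >].
  by exists #|` F|; apply/asboolP; rewrite [e]splitr.
case: (ex_minnP Q0) => N /asboolP cN Nmin; exfalso; apply: (h N); split => //.
by move=> N' cN'; apply: Nmin; apply/asboolP.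
Qed.

Lemma cover_num_gt0 w k e : 0 < e -> (0 < cover_num w k e)%N.
Proof. by move=> e0; have [/coverable_gt0] := cover_numP w k e e0. Qed.

Lemma cover_numM w k l e : 0 < e ->
  (cover_num w (k + l) e <=
   cover_num w k e * cover_num (iter k (@Defs.shift m) w) l e)%N.
Proof.
move=> e0; apply: (cover_numP w (k + l) e e0).2; apply: coverableM; first exact: ltW.
- exact: (cover_numP _ _ _ _).1.
- exact: (cover_numP _ _ _ _).1.
Qed.

Lemma prefix_dep_cover_num k e : prefix_dep k (fun w => cover_num w k e).
Proof.
move=> w w' ww'; rewrite /cover_num /coverable.
by rewrite (prefix_dep_bowen_dist f k w w').
Qed.

Lemma prefix_dep_max_separated_card k e :
  prefix_dep k (fun w => max_separated_card f w k e).
Proof.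
move=> w w' ww'; rewrite /max_separated_card /bowen_separated.
by rewrite (prefix_dep_bowen_dist f k w w').
Qed.

Local Open Scope ereal_scope.

Lemma max_separated_card_ge1 w k e : (0 < e)%R -> 1 <= max_separated_card f w k e.
Proof.
move=> e0; have [E [_ -> E0 _]] := maximal_separated f contf compX w k e e0.
by rewrite lee_fin ler1n.
Qed.

Lemma max_separated_card_le w k e : (0 < e)%R ->
  lne (max_separated_card f w k e) <= (ln (cover_num w k e)%:R)%:E.
Proof.
move=> e0; have [E [sE -> E0 _]] := maximal_separated f contf compX w k e e0.
rewrite lne_EFin ?ltr0n// lee_fin ler_ln ?posrE ?ltr0n ?cover_num_gt0//.
by rewrite ler_nat; apply: separated_coverable sE (cover_numP w k e e0).1.
Qed.

Lemma cover_num_le w k e : (0 < e)%R ->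
  (ln (cover_num w k (e + e))%:R)%:E <= lne (max_separated_card f w k e).
Proof.
move=> e0; have [E [sE -> E0 net]] := maximal_separated f contf compX w k e e0.
have e20 : (0 < e + e)%R by rewrite addr_gt0.
rewrite lne_EFin ?ltr0n// lee_fin ler_ln ?posrE ?ltr0n ?cover_num_gt0//.
by rewrite ler_nat; apply: (cover_numP w k _ e20).2; exact: coverable_net.
Qed.

Lemma le_max_separated_card w k e e' : (e <= e')%R ->
  max_separated_card f w k e' <= max_separated_card f w k e.
Proof.
move=> ee'; apply: ereal_sup_le => _ [E sE <-]; exists E => // x y xE yE xy.
by apply: le_lt_trans ee' _; exact: sE.
Qed.

Lemma le_lne (x y : \bar R) : 1 <= x -> x <= y -> lne x <= lne y.
Proof.
move=> x1 xy; have x0 : 0 <= x by rewrite (le_trans _ x1)// lee_fin.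
by rewrite lee_lne// in_itv/= leey ?x0 ?(le_trans x0).
Qed.

Lemma measurable_lne_max_separated_card k e :
  measurable_fun [set: Sigma m] (fun w => lne (max_separated_card f w k e)).
Proof.
apply: (measurable_fun_prefix_dep _ _ k) => w w' ww'.
by rewrite (prefix_dep_max_separated_card k e w w').
Qed.

Context {p : 'I_m.+1 -> R} {P : probability (Sigma m) R}.
Hypotheses (p_gt0 : forall i, (0 < p i)%R) (sum_p : (\sum_i p i = 1)%R).
Hypothesis bernP : is_bernoulli p P.

Definition log_sep_rate e k : \bar R :=
  (k%:R^-1)%:E * \int[P]_w lne (max_separated_card f w k e).

Lemma le_log_sep_rate e e' k : (0 < e)%R -> (e <= e')%R ->
  log_sep_rate e' k <= log_sep_rate e k.
Proof.
move=> e0 ee'; have e'0 : (0 < e')%R by exact: lt_le_trans ee'.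
apply: lee_wpmul2l; first by rewrite lee_fin invr_ge0.
apply: ge0_le_integral => //.
- by move=> w _; rewrite lne_ge0 max_separated_card_ge1.
- exact: measurable_lne_max_separated_card.
- exact: measurable_lne_max_separated_card.
- move=> w _; apply: le_lne; first exact: max_separated_card_ge1.
  exact: le_max_separated_card.
Qed.

(** Covering numbers, unlike separated sets, are submultiplicative along the
    orbit, so their logarithmic rate has a limit; separated sets are squeezed
    between covering numbers at two scales. *)
Lemma log_sep_rate_esup_einf e : (0 < e)%R ->
  limn_esup (log_sep_rate (e + e)) <= limn_einf (log_sep_rate e).
Proof.
move=> e0; have e20 : (0 < e + e)%R by rewrite addr_gt0.
pose a k w : R := ln (cover_num w k (e + e))%:R.
have da k : prefix_dep k (a k).
  by move=> w w' ww'; rewrite /a (prefix_dep_cover_num k _ w w').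
have a0 k w : (0 <= a k w)%R by rewrite ln_ge0// ler1n cover_num_gt0.
have ma k : measurable_fun [set: Sigma m] (fun w => (a k w)%:E).
  by apply/measurable_EFinP; exact: (measurable_fun_prefix_dep _ _ k).
have asub k l : \int[P]_w (a (k + l)%N w)%:E <=
    \int[P]_w (a k w)%:E + \int[P]_w (a l w)%:E.
  have mas : measurable_fun [set: Sigma m]
      (fun w => (a l (iter k (@Defs.shift m) w))%:E).
    apply/measurable_EFinP; apply: (measurable_fun_prefix_dep _ _ (k + l)).
    exact: prefix_dep_iter_shift.
  rewrite -(integral_iter_shift p_gt0 sum_p bernP k (fun w => (a l w)%:E))//; last first.
    by move=> w; rewrite lee_fin.
  rewrite -ge0_integralD//; [|by move=> w _; rewrite lee_fin..].
  apply: ge0_le_integral => //; [by move=> w _; rewrite lee_fin| |].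
    exact: emeasurable_funD.
  move=> w _; rewrite -EFinD lee_fin -lnM ?posrE ?ltr0n ?cover_num_gt0//.
  rewrite ler_ln ?posrE -?natrM ?ltr0n ?muln_gt0 ?cover_num_gt0//.
  by rewrite ler_nat; exact: cover_numM.
apply: (@le_trans _ _ (limn_esup (fun k => (k%:R^-1)%:E * \int[P]_w (a k w)%:E))).
  apply: le_limn_esup => k; apply: lee_wpmul2l; first by rewrite lee_fin invr_ge0.
  apply: ge0_le_integral => //.
  - by move=> w _; rewrite lne_ge0 max_separated_card_ge1.
  - exact: measurable_lne_max_separated_card.
  - by move=> w _; exact: max_separated_card_le.
apply: le_trans (fekete_integral a da a0 asub) _.
apply: le_limn_einf => k; apply: lee_wpmul2l; first by rewrite lee_fin invr_ge0.
apply: ge0_le_integral => //.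
- by move=> w _; rewrite lee_fin.
- exact: measurable_lne_max_separated_card.
- by move=> w _; exact: cover_num_le.
Qed.

Lemma top_entropyE : top_entropy f P =
  ereal_sup ((fun e => limn_einf (log_sep_rate e)) @` [set e | (0 < e)%R]).
Proof.
apply: lim_at_right0_sup => a b a0 ab; apply: le_limn_einf => k.
exact: le_log_sep_rate.
Qed.

Lemma le_top_entropy e : (0 < e)%R -> limn_einf (log_sep_rate e) <= top_entropy f P.
Proof. by move=> e0; rewrite top_entropyE; apply: ereal_sup_ubound; exists e. Qed.

Lemma log_sep_rate_le_top_entropy e : (0 < e)%R ->
  limn_esup (log_sep_rate (e + e)) <= top_entropy f P.
Proof.
move=> e0; apply: le_trans (log_sep_rate_esup_einf e e0) _; exact: le_top_entropy.
Qed.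

End covering_numbers.

(** * Moments of the inverse mass *)

Section correlation.
Context {R : realType} {X : pmetricType R} {m : nat}.
Variables (f : 'I_m.+1 -> X -> X) (mu : probability (borelType X) R).
Hypotheses (compX : compact [set: X]) (contf : forall i, continuous (f i)).
Hypothesis suppmu : full_support mu.
Implicit Types (w : Sigma m) (k : nat) (e q : R) (x : X).
Local Open Scope ereal_scope.

(** For [q < 1] this is the logarithm of the [L^(1 - q)] norm of the inverse
    mass, and for [q = 1] its limiting value, the mean information. It is
    nonincreasing in [q] by Jensen's inequality. *)
Definition renyi_info q w k e : \bar R :=
  if q == 1%R then \int[mu]_x (ln (inv_mass f mu w k e x))%:E
  else ((1 - q)^-1)%:E * lne (\int[mu]_x (inv_mass f mu w k e x `^ (1 - q))%:E).

Let mpow w k e (s : R) : (0 < e)%R ->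
  measurable_fun [set: borelType X] (fun x => inv_mass f mu w k e x `^ s)%R.
Proof.
move=> e0; apply: (measurableT_comp (measurable_powR _)).
exact: measurable_inv_mass.
Qed.

Let mln w k e : (0 < e)%R ->
  measurable_fun [set: borelType X] (fun x => (ln (inv_mass f mu w k e x))%:E).
Proof.
move=> e0; apply/measurable_EFinP; apply: (measurableT_comp (@measurable_ln R)).
exact: measurable_inv_mass.
Qed.

Let pow_ge1 w k e x (s : R) : (0 < e)%R -> (0 <= s)%R ->
  (1 <= inv_mass f mu w k e x `^ s)%R.
Proof.
by move=> e0 s0; rewrite -(powRr0 (inv_mass f mu w k e x)) ler_powR// inv_mass_ge1.
Qed.

Let int_pow_ge1 w k e (s : R) : (0 < e)%R -> (0 <= s)%R ->
  1 <= \int[mu]_x (inv_mass f mu w k e x `^ s)%:E.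
Proof.
move=> e0 s0; rewrite -[leLHS](@integral_probability_cst _ _ _ mu).
apply: ge0_le_integral => //.
- by apply/measurable_EFinP; exact: mpow.
- by move=> x _; rewrite lee_fin pow_ge1.
Qed.

Lemma renyi_info_ge0 q w k e : (0 < e)%R -> (0 <= q <= 1)%R ->
  0 <= renyi_info q w k e.
Proof.
move=> e0 /andP[q0 q1]; rewrite /renyi_info; case: eqP => _.
  by apply: integral_ge0 => x _; rewrite lee_fin ln_ge0// inv_mass_ge1.
rewrite mule_ge0 ?lee_fin ?invr_ge0 ?subr_ge0// lne_ge0 int_pow_ge1//.
by rewrite subr_ge0.
Qed.

Lemma prefix_dep_renyi_info q k e : prefix_dep k (fun w => renyi_info q w k e).
Proof.
move=> w w' ww'; rewrite /renyi_info /inv_mass.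
by rewrite (prefix_dep_ball_mass f mu k w w').
Qed.

Lemma measurable_renyi_info q k e :
  measurable_fun [set: Sigma m] (fun w => renyi_info q w k e).
Proof. exact: (measurable_fun_prefix_dep _ _ k _ (prefix_dep_renyi_info q k e)). Qed.

Lemma le_renyi_info q w k e e' : (0 <= q <= 1)%R -> (0 < e)%R -> (e <= e')%R ->
  renyi_info q w k e' <= renyi_info q w k e.
Proof.
move=> /andP[q0 q1] e0 ee'; have e'0 : (0 < e')%R by exact: lt_le_trans ee'.
have le_inv x : (inv_mass f mu w k e' x <= inv_mass f mu w k e x)%R.
  by rewrite lef_pV2 ?posrE ?ball_mass_gt0// le_ball_mass.
have inv0 x : (0 < inv_mass f mu w k e' x)%R.
  exact: inv_mass_gt0.
rewrite /renyi_info; case: eqP => _.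
  apply: ge0_le_integral => //; [|exact: mln|exact: mln|].
    by move=> x _; rewrite lee_fin ln_ge0// inv_mass_ge1.
  by move=> x _; rewrite lee_fin ler_ln ?posrE// (lt_le_trans (inv0 x)).
apply: lee_wpmul2l; first by rewrite lee_fin invr_ge0 subr_ge0.
apply: le_lne; first by rewrite int_pow_ge1// subr_ge0.
apply: ge0_le_integral => //.
- by move=> x _; rewrite lee_fin powR_ge0.
- by apply/measurable_EFinP; exact: mpow.
- by apply/measurable_EFinP; exact: mpow.
- move=> x _; rewrite lee_fin ge0_ler_powR ?nnegrE ?subr_ge0// ltW//.
  exact: lt_le_trans (le_inv x).
Qed.

Lemma integral_inv_mass_max_separated w k e : (0 < e)%R ->
  \int[mu]_x (inv_mass f mu w k (e + e) x)%:E <= max_separated_card f w k e.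
Proof.
move=> e0; have [E [_ -> _ net]] := maximal_separated f contf compX w k e e0.
exact: integral_inv_mass_le.
Qed.

Let int_fin w k e : (0 < e)%R -> \int[mu]_x (inv_mass f mu w k e x)%:E < +oo.
Proof.
move=> e0; rewrite [e]splitr.
have e20 : (0 < e / 2)%R by rewrite divr_gt0.
apply: (le_lt_trans (integral_inv_mass_max_separated w k _ e20)).
by have [E [_ -> _ _]] := maximal_separated f contf compX w k _ e20; rewrite ltry.
Qed.

(** Jensen's inequality for the logarithm of [inv_mass `^ (1 - q)]. *)
Lemma renyi_info1_le q w k e : (0 < e)%R -> (0 <= q <= 1)%R ->
  renyi_info 1 w k e <= renyi_info q w k e.
Proof.
move=> e0 /andP[q0 q1]; rewrite /renyi_info eqxx; case: eqP => [//|/eqP qn1].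
have s0 : (0 < 1 - q)%R by rewrite subr_gt0 lt_neqAle qn1.
rewrite lee_pdivlMl//.
rewrite -ge0_integralZl//; [|exact: mln| |]; last 2 first.
- by move=> x _; rewrite lee_fin ln_ge0// inv_mass_ge1.
- by rewrite lee_fin ltW.
under eq_integral do rewrite -EFinM -ln_powR.
apply: jensen_ln.
- exact: mpow.
- by move=> x; rewrite pow_ge1// ltW.
- apply: le_lt_trans (int_fin w k e e0).
  apply: ge0_le_integral => //.
  + by move=> x _; rewrite lee_fin powR_ge0.
  + by apply/measurable_EFinP; exact: mpow.
  + by apply/measurable_EFinP; exact: measurable_inv_mass.
  + by move=> x _; rewrite lee_fin ler1_powR ?inv_mass_ge1// gerBl.
Qed.

(** Jensen's inequality compares the [L^(1 - q)] norm with the [L^1] norm, which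
    is at most the number of points of a maximal separated set. *)
Lemma renyi_info_le q w k e : (0 < e)%R -> (0 <= q <= 1)%R ->
  renyi_info q w k (e + e) <= lne (max_separated_card f w k e).
Proof.
move=> e0 /andP[q0 q1]; have e20 : (0 < e + e)%R by rewrite addr_gt0.
have int_ge1 : 1 <= \int[mu]_x (inv_mass f mu w k (e + e) x)%:E.
  have := int_pow_ge1 w k (e + e) 1 e20 ler01.
  by under eq_integral do rewrite powRr1 ?ltW ?inv_mass_gt0//.
have fin1 : \int[mu]_x (inv_mass f mu w k (e + e) x)%:E \is a fin_num.
  by rewrite ge0_fin_numE ?int_fin// (le_trans _ int_ge1)// lee_fin.
apply: (@le_trans _ _ (lne (\int[mu]_x (inv_mass f mu w k (e + e) x)%:E))); last first.
  by apply: le_lne => //; exact: integral_inv_mass_max_separated.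
rewrite /renyi_info; case: eqP => [_|/eqP qn1].
  apply: jensen_ln; [exact: measurable_inv_mass| |exact: int_fin].
  by move=> x; exact: inv_mass_ge1.
have s0 : (0 < 1 - q)%R by rewrite subr_gt0 lt_neqAle qn1.
rewrite lee_pdivrMl//.
apply: le_trans (le_lne _ _ (int_pow_ge1 _ _ _ _ e20 (ltW s0)) (jensen_powR _ _ _ _ _ _)) _.
- exact: measurable_inv_mass.
- by move=> x; exact: inv_mass_ge1.
- exact: int_fin.
- by rewrite s0 gerBl.
have M0 : (0 < fine (\int[mu]_x (inv_mass f mu w k (e + e) x)%:E))%R.
  by rewrite -lte_fin fineK// (lt_le_trans _ int_ge1)// lte_fin.
rewrite lne_EFin ?powR_gt0// ln_powR -[X in lne X]fineK// lne_EFin//.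
Qed.

Variable P : probability (Sigma m) R.

Definition renyi_rate q e k : \bar R :=
  (k%:R^-1)%:E * \int[P]_w renyi_info q w k e.

Lemma correlation_sumE q e k : (0 < e)%R -> (0 <= q <= 1)%R ->
  - ((k%:R^-1)%:E * correlation_sum f P mu e k q) = renyi_rate q e k.
Proof.
move=> e0 q01; rewrite /renyi_rate -muleN; congr (_ * _).
have bE w x : mu (bowen_ball f w k x e) = (ball_mass f mu w k e x)%:E.
  exact: ball_massE.
have b0 w x : (0 < ball_mass f mu w k e x)%R by exact: ball_mass_gt0.
rewrite /correlation_sum /renyi_info; case: eqP => [_|/eqP qn1].
  rewrite -[RHS]oppeK; congr (- _).
  rewrite -integral_ge0N; last first.
    by move=> w _; apply: integral_ge0 => x _; rewrite lee_fin ln_ge0// inv_mass_ge1.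
  apply: eq_integral => w _; rewrite -integral_ge0N; last first.
    by move=> x _; rewrite lee_fin ln_ge0// inv_mass_ge1.
  apply: eq_integral => x _.
  by rewrite bE lne_EFin// -EFinN /inv_mass lnV ?posrE// opprK.
have s0 : (0 < 1 - q)%R by rewrite subr_gt0 lt_neqAle qn1; case/andP: q01.
transitivity (\int[P]_w ((1 - q)^-1%:E *
    lne (\int[mu]_x (inv_mass f mu w k e x `^ (1 - q))%:E))); last by [].
rewrite ge0_integralZl//; last 3 first.
- apply: (measurable_fun_prefix_dep _ _ k) => w w' ww'.
  by rewrite /inv_mass (prefix_dep_ball_mass f mu k w w').
- by move=> w _; rewrite lne_ge0 int_pow_ge1// ltW.
- by rewrite lee_fin invr_ge0 ltW.
rewrite -mulNe -EFinN -invrN opprB; congr (_ * _).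
apply: eq_integral => w _; congr lne; apply: eq_integral => x _.
rewrite bE poweR_EFin -(opprB q 1) /inv_mass -powR_inv1 ?ltW//.
by rewrite -powRrM mulN1r opprK.
Qed.

End correlation.

(** * Correlation entropies *)

Section fixed_moment.
Context {R : realType} {X : pmetricType R} {m : nat}.
Context {f : 'I_m.+1 -> X -> X} {mu : probability (borelType X) R}.
Context {P : probability (Sigma m) R} {p : 'I_m.+1 -> R}.
Hypotheses (compX : compact [set: X]) (contf : forall i, continuous (f i)).
Hypothesis suppmu : full_support mu.
Hypotheses (p_gt0 : forall i, 0 < p i) (sum_p : \sum_i p i = 1).
Hypothesis bernP : is_bernoulli p P.
Implicit Types (w : Sigma m) (k : nat) (e q : R) (x : X).
Local Open Scope ereal_scope.

Local Notation rate := (renyi_rate f mu P).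

Lemma le_renyi_rate q e e' k : (0 <= q <= 1)%R -> (0 < e)%R -> (e <= e')%R ->
  rate q e' k <= rate q e k.
Proof.
move=> q01 e0 ee'; have e'0 : (0 < e')%R by exact: lt_le_trans ee'.
apply: lee_wpmul2l; first by rewrite lee_fin invr_ge0.
apply: ge0_le_integral; first exact: measurableT.
- by move=> w _; exact: renyi_info_ge0.
- exact: measurable_renyi_info.
- exact: measurable_renyi_info.
- by move=> w _; exact: le_renyi_info.
Qed.

Lemma renyi_rate1_le q e k : (0 <= q <= 1)%R -> (0 < e)%R ->
  rate 1 e k <= rate q e k.
Proof.
move=> q01 e0; apply: lee_wpmul2l; first by rewrite lee_fin invr_ge0.
apply: ge0_le_integral; first exact: measurableT.
- by move=> w _; apply: renyi_info_ge0 => //; rewrite ler01 lexx.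
- exact: measurable_renyi_info.
- exact: measurable_renyi_info.
- by move=> w _; exact: renyi_info1_le.
Qed.

Lemma renyi_rate_le q e k : (0 <= q <= 1)%R -> (0 < e)%R ->
  rate q (e + e) k <= log_sep_rate f (P := P) e k.
Proof.
move=> q01 e0; have e20 : (0 < e + e)%R by rewrite addr_gt0.
apply: lee_wpmul2l; first by rewrite lee_fin invr_ge0.
apply: ge0_le_integral; first exact: measurableT.
- by move=> w _; exact: renyi_info_ge0.
- exact: measurable_renyi_info.
- exact: measurable_lne_max_separated_card.
- by move=> w _; exact: renyi_info_le.
Qed.

Lemma upper_correlation_entropyE q : (0 <= q <= 1)%R ->
  upper_correlation_entropy f P mu q =
  ereal_sup ((fun e => limn_esup (rate q e)) @` [set e | (0 < e)%R]).
Proof.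
move=> q01.
have E e : (0 < e)%R -> (fun k => - ((k%:R^-1)%:E * correlation_sum f P mu e k q)) =
    rate q e.
  by move=> e0; apply/funext => k; exact: correlation_sumE.
rewrite /upper_correlation_entropy lim_at_right0_sup => [|a b a0 ab].
  by congr ereal_sup; apply: eq_imagel => e e0; congr limn_esup; exact: E.
have b0 : (0 < b)%R by exact: lt_le_trans ab.
suff : limn_esup (rate q b) <= limn_esup (rate q a).
  by rewrite -(E b b0) -(E a a0).
by apply: le_limn_esup => k; exact: le_renyi_rate.
Qed.

Lemma lower_correlation_entropyE q : (0 <= q <= 1)%R ->
  lower_correlation_entropy f P mu q =
  ereal_sup ((fun e => limn_einf (rate q e)) @` [set e | (0 < e)%R]).
Proof.
move=> q01.
have E e : (0 < e)%R -> (fun k => - ((k%:R^-1)%:E * correlation_sum f P mu e k q)) =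
    rate q e.
  by move=> e0; apply/funext => k; exact: correlation_sumE.
rewrite /lower_correlation_entropy lim_at_right0_sup => [|a b a0 ab].
  by congr ereal_sup; apply: eq_imagel => e e0; congr limn_einf; exact: E.
have b0 : (0 < b)%R by exact: lt_le_trans ab.
suff : limn_einf (rate q b) <= limn_einf (rate q a).
  by rewrite -(E b b0) -(E a a0).
by apply: le_limn_einf => k; exact: le_renyi_rate.
Qed.

(** The scale is halved twice: from the radius of balls to the separation of
    a net, and once more to exchange the limits superior and inferior. *)
Lemma upper_correlation_entropy_le q : (0 <= q <= 1)%R ->
  upper_correlation_entropy f P mu q <= top_entropy f P.
Proof.
move=> q01; rewrite upper_correlation_entropyE//; apply: ge_ereal_sup => _ [e e0 <-].
pose d := (e / 4)%R; have d0 : (0 < d)%R by rewrite divr_gt0.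
have -> : e = (d + d + (d + d))%R by rewrite /d; field.
apply: le_trans (log_sep_rate_le_top_entropy f compX contf p_gt0 sum_p bernP _ d0).
have dd0 : (0 < d + d)%R by rewrite addr_gt0.
by apply: le_limn_esup => k; exact: (renyi_rate_le q (d + d) k q01 dd0).
Qed.

Let info e k (z : Sigma m * borelType X) : \bar R :=
  (k%:R^-1 * ln (inv_mass f mu z.1 k e z.2))%:E.

Let info_ge0 e k z : (0 < e)%R -> 0 <= info e k z.
Proof. by move=> e0; rewrite lee_fin mulr_ge0 ?invr_ge0// ln_ge0// inv_mass_ge1. Qed.

Let minfo e k : (0 < e)%R -> measurable_fun setT (info e k).
Proof.
move=> e0.
have minv : measurable_fun [set: Sigma m * borelType X]
    (fun z => inv_mass f mu z.1 k e z.2).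
  apply: (measurable_prefix_dep_prod k
    (fun (w : Sigma m) (x : borelType X) => inv_mass f mu w k e x)).
    by move=> w w' ww'; rewrite /inv_mass (prefix_dep_ball_mass f mu k w w').
  by move=> w; exact: measurable_inv_mass.
apply/measurable_EFinP; apply: measurable_funM => //.
exact: (measurableT_comp (@measurable_ln R) minv).
Qed.

Let integral_info e k : (0 < e)%R ->
  \int[P \x mu]_z info e k z = rate 1 e k.
Proof.
move=> e0; rewrite fubini_tonelli1//=; [|exact: minfo|by move=> z; exact: info_ge0].
rewrite /renyi_rate -ge0_integralZl//; last 2 first.
- exact: measurable_renyi_info.
- by move=> w _; apply: renyi_info_ge0 => //; rewrite ler01 lexx.
apply: eq_integral => w _; rewrite /fubini_F /renyi_info eqxx -ge0_integralZl//.
- apply/measurable_EFinP; apply: (measurableT_comp (@measurable_ln R)).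
  exact: measurable_inv_mass.
- by move=> x _; rewrite lee_fin ln_ge0// inv_mass_ge1.
Qed.

Let local_info e z := limn_einf (fun k => info e k z).

Let le_local_info e e' z : (0 < e)%R -> (e <= e')%R -> local_info e' z <= local_info e z.
Proof.
move=> e0 ee'; have e'0 : (0 < e')%R by exact: lt_le_trans ee'.
apply: le_limn_einf => k; rewrite lee_fin ler_wpM2l ?invr_ge0//.
by rewrite ler_ln ?posrE ?inv_mass_gt0// lef_pV2 ?posrE ?ball_mass_gt0// le_ball_mass.
Qed.

Let local_entropyE z : local_entropy f mu z.1 z.2 =
  ereal_sup ((fun e => local_info e z) @` [set e | (0 < e)%R]).
Proof.
have E e : (0 < e)%R -> limn_einf (fun k =>
   - ((k%:R^-1)%:E * lne (mu (bowen_ball f z.1 k z.2 e)))) = local_info e z.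
  move=> e0; congr limn_einf; apply/funext => k.
  rewrite ball_massE// lne_EFin ?ball_mass_gt0// -EFinM -EFinN /info.
  by rewrite /inv_mass lnV ?posrE ?ball_mass_gt0// mulrN.
rewrite /local_entropy lim_at_right0_sup => [|a b a0 ab].
  by congr ereal_sup; apply/seteqP; split => _ [e e0 <-]; exists e => //; rewrite E.
rewrite !E//; last exact: lt_le_trans ab.
exact: le_local_info.
Qed.

Let nd_local z : nondecreasing_seq (fun n => local_info n.+1%:R^-1 z).
Proof.
move=> i j ij; apply: le_local_info; first by rewrite invr_gt0.
by rewrite lef_pV2 ?posrE// ler_nat.
Qed.

Let local_entropy_limn z : local_entropy f mu z.1 z.2 =
  limn (fun n => local_info n.+1%:R^-1 z).
Proof.
rewrite local_entropyE (cvg_lim _ (ereal_nondecreasing_cvgn (nd_local z)))//.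
apply/eqP; rewrite eq_le; apply/andP; split; last first.
  apply: ereal_sup_le => _ [n _ <-]; exists n.+1%:R^-1%R => //=.
apply: ge_ereal_sup => _ [e e0 <-].
have [n _ /(_ n (leqnn n)) ne] := near_infty_natSinv_lt (PosNum e0).
apply: le_trans (ereal_sup_ubound _); last by exists n.
apply: le_local_info; first by rewrite invr_gt0.
exact: ltW.
Qed.

Let mlocal e : (0 < e)%R -> measurable_fun setT (local_info e).
Proof.
move=> e0; apply: (measurableT_comp (f := -%E)) => //.
apply: measurable_fun_limn_esup => k; apply: measurableT_comp => //.
exact: minfo.
Qed.

Let local_ge0 e z : (0 < e)%R -> 0 <= local_info e z.
Proof.
move=> e0; rewrite /local_info limn_einfE; apply: le_trans (ereal_sup_ubound _).
  2: by exists 0%N.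
by apply: le_ereal_inf_tmp => _ [k _ <-]; exact: info_ge0.
Qed.

Lemma top_entropy_ge0 : 0 <= top_entropy f P.
Proof.
apply: le_trans (le_top_entropy f compX contf 1 ltr01).
rewrite limn_einfE; apply: le_trans (ereal_sup_ubound _).
  2: by exists 0%N.
apply: le_ereal_inf_tmp => _ [k _ <-]; rewrite mule_ge0 ?lee_fin ?invr_ge0//.
by apply: integral_ge0 => w _; rewrite lne_ge0 max_separated_card_ge1.
Qed.

(** Fatou's lemma bounds the mean information rate below by the mean of the
    local entropies at scale [e], and these increase to the local entropy. *)
Lemma top_entropy_le_lower_correlation1 :
  {ae (P \x mu)%E, forall z, top_entropy f P <= local_entropy f mu z.1 z.2} ->
  top_entropy f P <= lower_correlation_entropy f P mu 1.
Proof.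
move=> ae_local; have inv0 n : (0 < n.+1%:R^-1 :> R)%R by rewrite invr_gt0.
have PmuT : (P \x mu) setT = 1.
  by rewrite -setXTT product_measure1E//= !probability_setT mule1.
have -> : top_entropy f P = \int[P \x mu]_z cst (top_entropy f P) z.
  by rewrite integral_cst// [X in _ * X]PmuT mule1.
apply: (@le_trans _ _ (\int[P \x mu]_z limn (fun n => local_info n.+1%:R^-1 z))).
  apply: ae_ge0_le_integral => //.
  - by move=> z _; exact: top_entropy_ge0.
  - move=> z _; rewrite -local_entropy_limn local_entropyE.
    apply: le_trans (local_ge0 1%R z ltr01) _; apply: ereal_sup_ubound.
    by exists 1%R => //=; exact: ltr01.
  - apply: (@emeasurable_fun_cvg _ _ _ _ (fun n => local_info n.+1%:R^-1)).
      by move=> n; exact: mlocal.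
    by move=> z _; exact: ereal_nondecreasing_is_cvgn.
  - have [N [mN N0 sN]] := ae_local; exists N; split => // z h.
    by apply: sN => /= h'; apply: h => _; rewrite -local_entropy_limn.
rewrite monotone_convergence//; [|by move=> n; exact: mlocal
  |by move=> n z _; exact: local_ge0].
apply: lime_le.
  apply: ereal_nondecreasing_is_cvgn => i j ij; apply: ge0_le_integral => //.
  - by move=> z _; exact: local_ge0.
  - exact: mlocal.
  - exact: mlocal.
  - by move=> z _; exact: nd_local.
apply: nearW => n; apply: le_trans (fatou _ _ _ _) _ => //.
- by move=> k; exact: minfo.
- by move=> k z _; exact: info_ge0.
rewrite lower_correlation_entropyE; last by rewrite ler01 lexx.
apply: ereal_sup_ubound; exists n.+1%:R^-1%R; first exact: inv0.
by congr limn_einf; apply/funext => k; rewrite integral_info.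
Qed.

(** The case [q = 1] bounds every [q] from below, and the separated sets bound
    every [q] from above. *)
Lemma correlation_entropy_top q :
  {ae (P \x mu)%E, forall z, top_entropy f P <= local_entropy f mu z.1 z.2} ->
  (0 <= q <= 1)%R ->
  lower_correlation_entropy f P mu q = top_entropy f P /\
  upper_correlation_entropy f P mu q = top_entropy f P.
Proof.
move=> ae_local q01.
have lo : top_entropy f P <= lower_correlation_entropy f P mu q.
  apply: le_trans (top_entropy_le_lower_correlation1 ae_local) _.
  have q11 : (0 <= (1 : R) <= 1)%R by rewrite ler01 lexx.
  rewrite (lower_correlation_entropyE 1 q11) (lower_correlation_entropyE q q01).
  apply: ge_ereal_sup => _ [e e0 <-]; apply: le_trans (ereal_sup_ubound _).
    2: by exists e.
  by apply: le_limn_einf => k; exact: (renyi_rate1_le q e k q01 e0).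
have mid : lower_correlation_entropy f P mu q <= upper_correlation_entropy f P mu q.
  rewrite (lower_correlation_entropyE q q01) (upper_correlation_entropyE q q01).
  apply: ge_ereal_sup => _ [e e0 <-]; apply: le_trans (ereal_sup_ubound _).
    2: by exists e.
  exact: limn_einf_sup.
have hi := upper_correlation_entropy_le q q01.
by split; apply: le_anti; apply/andP; split;
  [exact: le_trans mid hi|exact: lo|exact: hi|exact: le_trans lo mid].
Qed.

End fixed_moment.

(** * Shannon entropy of finite-valued maps *)

Section entropy_terms.
Context {R : realType}.
Implicit Types t s : R.

(** The graph of the concave function [- t ln t] lies below its tangent at [s].
    Summed over the values of a random variable, this is Gibbs' inequality. *)
Lemma entropy_tangent t s : 0 <= t -> 0 < s -> - (t * ln t) <= - (t * ln s) + s - t.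
Proof.
rewrite le_eqVlt => /predU1P[<- s0|t0 s0].
  rewrite !mul0r; lra.
have := @le_ln1Dx R (s / t - 1).
rewrite subrKC ltrBDl subrr divr_gt0// => /(_ isT).
rewrite ln_div// ?posrE// => h.
have := ler_wpM2l (ltW t0) h.
rewrite !mulrBr mulrCA mulfV ?gt_eqF// mulr1; lra.
Qed.

(** The tangent at [1], applied to the square root. *)
Lemma entropy_term_le_sqrt t : 0 <= t -> - (t * ln t) <= 2 * Num.sqrt t.
Proof.
rewrite le_eqVlt => /predU1P[<-|t0]; first by rewrite mul0r oppr0 sqrtr0 mulr0.
have s0 : 0 < Num.sqrt t by rewrite sqrtr_gt0.
have := entropy_tangent (Num.sqrt t) 1 (ltW s0) ltr01.
rewrite ln1 mulr0 oppr0 add0r => h.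
rewrite -{1 2}(sqr_sqrtr (ltW t0)) lnXn// mulr2n expr2 -mulrA.
have := ler_wpM2l (ltW s0) h; rewrite mulrBr mulr1 => h'.
have := sqr_ge0 (Num.sqrt t); rewrite expr2 => h''.
have h2 : Num.sqrt t * - (Num.sqrt t * ln (Num.sqrt t)) <= Num.sqrt t by lra.
rewrite mulrDr; lra.
Qed.

End entropy_terms.

Lemma sum_option {R : realType} {I : finType} (F : option I -> R) :
  \sum_i F i = F None + \sum_i F (Some i).
Proof.
rewrite (bigD1 None)//=; congr (_ + _); rewrite (reindex_omap Some id)//=.
  by apply: eq_bigl => i; rewrite eqxx.
by case.
Qed.

Section finite_valued.
Context {d} {T : measurableType d} {R : realType} {mu : probability T R}.

(** A finite type carries no canonical sigma-algebra, so that measurability of a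
    finite-valued map is asked of its fibres. *)
Definition fib_measurable {I : finType} (U : T -> I) : Prop :=
  forall i, measurable (U @^-1` [set i]).

Definition law {I : finType} (U : T -> I) (i : I) : R := fine (mu (U @^-1` [set i])).

Definition entropy {I : finType} (U : T -> I) : R :=
  \sum_i - (law U i * ln (law U i)).

Lemma fib_measurable_comp {I J : finType} (psi : I -> J) (U : T -> I) :
  fib_measurable U -> fib_measurable (psi \o U).
Proof.
move=> mU j.
rewrite (_ : _ @^-1` _ = \bigcup_(i in [set i | psi i = j]) (U @^-1` [set i])).
  by apply: fin_bigcup_measurable => //; exact: finite_finset.
by apply/seteqP; split => [x <-|x [i /= <- ->]//]; exists (U x).
Qed.

Lemma fib_measurable_ffun {I J : finType} (U : J -> T -> I) :
  (forall j, fib_measurable (U j)) ->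
  fib_measurable (fun x => [ffun j => U j x]).
Proof.
move=> mU s.
rewrite (_ : _ @^-1` _ = \bigcap_(j in [set: J]) (U j @^-1` [set s j])).
  by apply: fin_bigcap_measurable => // j _; exact: mU.
apply/seteqP; split => [x <- j _ /=|x h]; first by rewrite ffunE.
by apply/ffunP => j; rewrite ffunE; exact: (h j).
Qed.

Lemma fib_measurable_pair {I J : finType} (U : T -> I) (V : T -> J) :
  fib_measurable U -> fib_measurable V -> fib_measurable (fun x => (U x, V x)).
Proof.
move=> mU mV [i j]; rewrite (_ : _ @^-1` _ = U @^-1` [set i] `&` V @^-1` [set j]).
  exact: measurableI.
by apply/seteqP; split => [x [<- <-]|x [/= -> ->]].
Qed.

Lemma lawE {I : finType} (U : T -> I) i : fib_measurable U ->
  mu (U @^-1` [set i]) = (law U i)%:E.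
Proof. by move=> mU; rewrite fineK// fin_num_measure. Qed.

Lemma law_ge0 {I : finType} (U : T -> I) i : 0 <= law U i.
Proof. by rewrite fine_ge0. Qed.

Lemma law_comp {I J : finType} (psi : I -> J) (U : T -> I) j :
  fib_measurable U -> law (psi \o U) j = \sum_(i | psi i == j) law U i.
Proof.
move=> mU.
have mus (s : seq I) : uniq s ->
    mu [set x | U x \in s] = (\sum_(i <- s) law U i)%:E.
  elim: s => [_|a s ih /= /andP[as_ us]].
    rewrite big_nil (_ : [set x | _] = set0) ?measure0//.
    by apply/seteqP; split.
  rewrite big_cons EFinD -ih// -lawE// -measureU//.
  - congr (mu _); apply/seteqP; split => x /=; rewrite in_cons.
      by case/predU1P; [left|right].
    by case=> ->; rewrite ?eqxx ?orbT.
  - by have := fib_measurable_comp (fun i => i \in s) U mU true.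
  - by apply/seteqP; split => // x [/= ->]; rewrite (negbTE as_).
apply: EFin_inj; rewrite -lawE; last exact: fib_measurable_comp.
have <- : \sum_(i <- enum [pred i | psi i == j]) law U i =
  \sum_(i | psi i == j) law U i by rewrite big_enum.
rewrite -mus ?enum_uniq//.
by congr (mu _); apply/seteqP; split => x /=; rewrite mem_enum inE => /eqP.
Qed.

Lemma sum_law {I : finType} (U : T -> I) : fib_measurable U -> \sum_i law U i = 1.
Proof.
move=> mU; have := law_comp (fun=> tt) U tt mU.
rewrite (eq_bigl xpredT)// => <-; rewrite /law (_ : _ @^-1` _ = setT).
  by rewrite probability_setT.
by apply/seteqP; split.
Qed.

Lemma law_le1 {I : finType} (U : T -> I) i : fib_measurable U -> law U i <= 1.
Proof.
move=> mU; rewrite -(sum_law U mU) (bigD1 i)//= lerDl sumr_ge0// => j _.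
exact: law_ge0.
Qed.

Lemma entropy_ge0 {I : finType} (U : T -> I) : fib_measurable U -> 0 <= entropy U.
Proof.
move=> mU; apply: sumr_ge0 => i _.
by rewrite -mulrN mulr_ge0 ?law_ge0// oppr_ge0 ln_le0// law_le1.
Qed.

Lemma entropy_comp_le {I J : finType} (psi : I -> J) (U : T -> I) :
  fib_measurable U -> entropy (psi \o U) <= entropy U.
Proof.
move=> mU; rewrite /entropy.
rewrite [leRHS](partition_big psi xpredT)//=; apply: ler_sum => j _.
rewrite {1}law_comp// mulr_suml -sumrN; apply: ler_sum => i /eqP ij.
rewrite lerN2; have [->|u0] := eqVneq (law U i) 0; first by rewrite !mul0r.
have ui0 : 0 < law U i by rewrite lt_neqAle eq_sym u0 law_ge0.
have le_law : law U i <= law (psi \o U) j.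
  rewrite law_comp// (bigD1 i) ?ij//= lerDl sumr_ge0// => i' _.
  exact: law_ge0.
rewrite ler_wpM2l ?law_ge0// ler_ln ?posrE//.
exact: lt_le_trans le_law.
Qed.

Lemma entropy_determined_le {I J : finType} (U : T -> I) (V : T -> J) :
  fib_measurable U -> (forall x y, U x = U y -> V x = V y) ->
  entropy V <= entropy U.
Proof.
move=> mU UV; pose psi i := V (xget point (U @^-1` [set i])).
rewrite (_ : V = psi \o U); first exact: entropy_comp_le.
apply/funext => x /=; apply: UV; case: xgetP => [y _ <-//|].
by move=> /(_ x)/(_ erefl).
Qed.

(** Gibbs' inequality against the product of the marginal laws. *)
Lemma entropy_pair_le {I J : finType} (U : T -> I) (V : T -> J) :
  fib_measurable U -> fib_measurable V ->
  entropy (fun x => (U x, V x)) <= entropy U + entropy V.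
Proof.
move=> mU mV; pose W x := (U x, V x).
have mW : fib_measurable W by exact: fib_measurable_pair.
have lawU i : law U i = \sum_j law W (i, j).
  rewrite -[U]/(fst \o W) law_comp//.
  transitivity (\sum_(a | a == i) \sum_j law W (a, j)); last by rewrite big_pred1_eq.
  by rewrite pair_big/=; apply: eq_big => [c|[]//]; rewrite andbT.
have lawV j : law V j = \sum_i law W (i, j).
  rewrite -[V]/(snd \o W) law_comp//.
  transitivity (\sum_i \sum_(b | b == j) law W (i, b)).
    by rewrite pair_big/=; apply: eq_bigr => -[].
  by apply: eq_bigr => i _; rewrite big_pred1_eq.
have WU i j : law W (i, j) <= law U i.
  by rewrite lawU (bigD1 j)//= lerDl sumr_ge0// => *; exact: law_ge0.
have WV i j : law W (i, j) <= law V j.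
  by rewrite lawV (bigD1 i)//= lerDl sumr_ge0// => *; exact: law_ge0.
have sumW : \sum_i \sum_j law W (i, j) = 1.
  by rewrite -(sum_law U mU); apply: eq_bigr => i _; rewrite lawU.
have -> : entropy W = \sum_i \sum_j - (law W (i, j) * ln (law W (i, j))).
  by rewrite /entropy pair_bigA/=; apply: eq_bigr => -[].
have -> : entropy U + entropy V = \sum_i \sum_j
   (- (law W (i, j) * ln (law U i)) - (law W (i, j) * ln (law V j)) +
     law U i * law V j - law W (i, j)).
  rewrite (eq_bigr (fun i => - (law U i * ln (law U i)) +
     \sum_j - (law W (i, j) * ln (law V j)) + law U i - \sum_j law W (i, j))); last first.
    move=> i _; rewrite !big_split/= !sumrN -mulr_suml -lawU -mulr_sumr.
    by rewrite sum_law// mulr1.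
  rewrite !big_split/= !sumrN sumW sum_law// exchange_big/= addrK.
  rewrite -sumrN; congr (_ + _); apply: eq_bigr => j _.
  by rewrite sumrN -mulr_suml -lawV.
apply: ler_sum => i _; apply: ler_sum => j _.
have [w0|w0] := eqVneq (law W (i, j)) 0.
  by rewrite w0 !mul0r; have := mulr_ge0 (law_ge0 U i) (law_ge0 V j); lra.
have {}w0 : 0 < law W (i, j) by rewrite lt_neqAle eq_sym w0 law_ge0.
have u0 : 0 < law U i by exact: lt_le_trans (WU i j).
have v0 : 0 < law V j by exact: lt_le_trans (WV i j).
rewrite -opprD -mulrDr -lnM//; apply: entropy_tangent; first exact: ltW.
exact: mulr_gt0.
Qed.

(** Gibbs' inequality against the uniform law. *)
Lemma entropy_le_card {I : finType} (U : T -> I) (N : nat) :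
  fib_measurable U -> (#|I| <= N)%N -> entropy U <= ln N%:R.
Proof.
move=> mU IN; have I0 : (0 < #|I|)%N by apply/card_gt0P; exists (U point).
apply: (@le_trans _ _ (ln #|I|%:R)); last first.
  by rewrite ler_ln ?posrE ?ltr0n// ?ler_nat// (leq_trans I0).
have c0 : 0 < #|I|%:R^-1 :> R by rewrite invr_gt0 ltr0n.
apply: (@le_trans _ _
    (\sum_i (- (law U i * ln #|I|%:R^-1) + #|I|%:R^-1 - law U i))).
  by apply: ler_sum => i _; apply: entropy_tangent => //; exact: law_ge0.
rewrite !big_split/= !sumrN -mulr_suml sum_law// mul1r lnV ?posrE ?ltr0n// opprK.
by rewrite sumr_const -[_^-1 *+ _]mulr_natl mulfV ?addrK// pnatr_eq0 -lt0n.
Qed.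

Lemma entropy_ffun_le {I : finType} k (U : nat -> T -> I) :
  (forall i, fib_measurable (U i)) ->
  entropy (fun x => [ffun i : 'I_k => U i x]) <= \sum_(i < k) entropy (U i).
Proof.
move=> mU; elim: k => [|k ih].
  rewrite big_ord0 -[leRHS](@ln1 R); apply: (entropy_le_card _ 1).
    exact: fib_measurable_ffun.
  by rewrite card_ffun card_ord expn0.
rewrite big_ord_recr/=; apply: le_trans (lerD ih (lexx _)).
apply: le_trans (entropy_pair_le _ _ (fib_measurable_ffun _ _) (mU k)) => //.
apply: entropy_determined_le.
  by apply: fib_measurable_pair => //; exact: fib_measurable_ffun.
move=> x y [/ffunP xy xyk]; apply/ffunP => i; rewrite !ffunE.
have [ik|ki] := ltnP i k; first by have := xy (Ordinal ik); rewrite !ffunE.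
by have -> : i = k :> nat by have := ltn_ord i; lia.
Qed.

(** Each value [Some i] has probability at most [t] and contributes at most
    [2 * sqrt t]; the tangent at [1] bounds the contribution of [None] by [t]. *)
Lemma entropy_option_le {I : finType} (U : T -> option I) (t : R) :
  fib_measurable U -> 1 - law U None <= t ->
  entropy U <= t + #|I|%:R * (2 * Num.sqrt t).
Proof.
move=> mU Ut.
have sumU : law U None + \sum_i law U (Some i) = 1.
  by rewrite -(sum_law U mU) sum_option.
rewrite /entropy !sum_option lerD//.
  have := entropy_tangent (law U None) 1 (law_ge0 _ _) ltr01.
  by rewrite ln1 mulr0 oppr0 add0r => /le_trans; apply.
rewrite mulr_natl -sumr_const; apply: ler_sum => i _.
apply: le_trans (entropy_term_le_sqrt _ (law_ge0 _ _)) _.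
rewrite ler_wpM2l// ler_wsqrtr//; apply: le_trans Ut.
rewrite -sumU addrAC subrr add0r (bigD1 i)//= lerDl sumr_ge0// => j _.
exact: law_ge0.
Qed.

End finite_valued.

(** * Separating the cells of a Borel partition *)

Section separation_of_measurable_sets.
Context {R : realType} {X : pmetricType R} {mu : probability (borelType X) R}.
Implicit Types A B : set X.
Local Open Scope ereal_scope.

(** Off a set of small measure, membership in [A] is locally constant at a
    uniform scale. *)
Definition almost_clopen A : Prop := forall d : R, (0 < d)%R ->
  exists (e : R) (N : set (borelType X)), [/\ (0 < e)%R, measurable N, mu N < d%:E &
    forall x y : X, ~ N x -> ~ N y -> (mdist x y <= e)%R -> A x -> A y].

Lemma almost_clopenC A : almost_clopen A -> almost_clopen (~` A).
Proof.
move=> cA d /cA[e [N [e0 mN Nd sep]]]; exists e, N; split => // x y Nx Ny xy Ax Ay.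
by apply: Ax; apply: sep Ay => //; rewrite metric_sym.
Qed.

Lemma almost_clopenU A B : almost_clopen A -> almost_clopen B -> almost_clopen (A `|` B).
Proof.
move=> cA cB d d0; have d20 : (0 < d / 2)%R by rewrite divr_gt0.
have [e [N [e0 mN Nd sA]]] := cA _ d20; have [e' [N' [e'0 mN' N'd sB]]] := cB _ d20.
exists (Num.min e e'), (N `|` N'); split.
- by rewrite lt_min e0.
- exact: measurableU.
- apply: le_lt_trans (measureU2 mu mN mN') _.
  by rewrite [d]splitr EFinD lteD.
- move=> x y /not_orP[Nx N'x] /not_orP[Ny N'y]; rewrite le_min => /andP[xy xy'].
  by case=> [Ax|Bx]; [left; exact: sA Ax|right; exact: sB Bx].
Qed.

(** Only finitely many sets matter up to a tail of small measure, which is put in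
    the exceptional set. *)
Lemma almost_clopen_bigcup (F : nat -> set X) :
  (forall n, measurable (F n : set (borelType X))) ->
  (forall n, almost_clopen (F n)) -> almost_clopen (\bigcup_n F n).
Proof.
move=> mF cF d d0; have d20 : (0 < d / 2)%R by rewrite divr_gt0.
pose S n := \big[setU/set0]_(i < n) F i.
have mS n : measurable (S n : set (borelType X)) by exact: bigsetU_measurable.
have mA : measurable (\bigcup_n F n : set (borelType X)) by exact: bigcupT_measurable.
have cS n : almost_clopen (S n).
  elim: n => [|n ih]; rewrite /S; last by rewrite big_ord_recr; exact: almost_clopenU.
  rewrite big_ord0 => c c0; exists 1%R, set0; split => //.
  by rewrite measure0 lte_fin.
pose D n : set (borelType X) := (\bigcup_n F n) `\` S n.
have capD : \bigcap_n D n = set0.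
  apply/seteqP; split => // x /= h; have [[n _ Fx] _] := h 0%N I.
  have [_] := h n.+1 I; apply; rewrite /S big_ord_recr; right; exact: Fx.
have : mu \o D @ \oo --> mu (\bigcap_n D n).
  apply: nonincreasing_cvg_mu.
  - by apply: le_lt_trans (probability_le1 _ _) (ltry _); exact: measurableD.
  - by move=> n; exact: measurableD.
  - by apply: bigcapT_measurable => n; exact: measurableD.
  - move=> i j ij; apply/subsetPset; apply: setDS; exact: subset_bigsetU.
rewrite capD measure0 => /fine_cvgP[_ /cvgr_lt /(_ _ d20)][n _ /(_ n (leqnn n))/= Dd].
have mDn : measurable (D n) by exact: measurableD.
have {}Dd : mu (D n) < (d / 2)%:E by rewrite -[ltLHS]fineK ?fin_num_measure// lte_fin.
have [e [N [e0 mN Nd sep]]] := cS n _ d20.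
exists e, (D n `|` N); split => //.
- by apply: measurableU => //; exact: measurableD.
- apply: le_lt_trans (measureU2 mu _ mN) _; first exact: measurableD.
  by rewrite [d]splitr EFinD lteD.
- move=> x y /not_orP[Dx Nx] /not_orP[Dy Ny] xy Ax.
  have Sx : S n x by apply: contrapT => nSx; apply: Dx; split.
  have := sep x y Nx Ny xy Sx; rewrite /S -bigcup_mkord => -[i _ Fy].
  by exists i.
Qed.

(** The exceptional set consists of the points of [U] within distance [1 / n] of
    the complement of [U]; these sets decrease to the empty set. *)
Lemma almost_clopen_open (U : set X) : open U -> almost_clopen U.
Proof.
move=> oU d d0.
pose C n : set X := [set x | forall y, (mdist x y < n.+1%:R^-1)%R -> U y].
have mC n : measurable (C n : set (borelType X)).
  rewrite -[X in measurable X]setCK; apply: measurableC; apply: sub_sigma_algebra.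
  rewrite openE => x /= /existsNP[y /not_implyP[xy nUy]].
  have r0 : (0 < n.+1%:R^-1 - mdist x y)%R by rewrite subr_gt0.
  rewrite /interior; apply: filterS (nbhsx_ballx x _ r0) => x'.
  rewrite ballEmdist/= => xx' /(_ y) h; apply: nUy; apply: h.
  apply: le_lt_trans (metric_triangle x' x y) _.
  by rewrite (metric_sym x' x) -ltrBrDr.
pose D n : set (borelType X) := U `\` C n.
have mU : measurable (U : set (borelType X)) by exact: sub_sigma_algebra.
have capD : \bigcap_n D n = set0.
  apply/seteqP; split => // x /= h; have [Ux _] := h 0%N I.
  move: oU; rewrite openE => /(_ x Ux); rewrite /interior -nbhs_ballE => -[r r0 rU].
  have [n _ /(_ n (leqnn n)) nr] := near_infty_natSinv_lt (PosNum r0).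
  have [_] := h n I; apply => y xy; apply: rU; rewrite ballEmdist/=.
  exact: lt_trans nr.
have : mu \o D @ \oo --> mu (\bigcap_n D n).
  apply: nonincreasing_cvg_mu.
  - by apply: le_lt_trans (probability_le1 _ _) (ltry _); exact: measurableD.
  - by move=> n; exact: measurableD.
  - by apply: bigcapT_measurable => n; exact: measurableD.
  - move=> i j ij; apply/subsetPset; apply: setDS => x h y xy; apply: h.
    by apply: lt_le_trans xy _; rewrite lef_pV2 ?posrE// ler_nat.
rewrite capD measure0 => /fine_cvgP[_ /cvgr_lt /(_ _ d0)][n _ /(_ n (leqnn n))/= Dd].
have mDn : measurable (D n) by exact: measurableD.
exists (n.+1%:R^-1 / 2)%R, (D n); split => //.
- by rewrite -[ltLHS]fineK ?fin_num_measure// lte_fin.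
- move=> x y Dx _ xy Ux.
  have Cx : C n x by apply: contrapT => nCx; apply: Dx; split.
  apply: Cx; apply: le_lt_trans xy _.
  by rewrite ltr_pdivrMr// ltr_pMr ?invr_gt0// ltr1n.
Qed.

(** The almost clopen Borel sets form a sigma-algebra containing the open
    sets. *)
Lemma measurable_almost_clopen (A : set (borelType X)) : measurable A -> almost_clopen A.
Proof.
move=> mA; suff [] : measurable A /\ almost_clopen A by [].
move: A mA; apply: smallest_sub; last first.
  by move=> U oU; split; [exact: sub_sigma_algebra|exact: almost_clopen_open].
split.
- split; first exact: measurable0.
  by move=> d d0; exists 1%R, set0; split => //; rewrite measure0 lte_fin.
- move=> A [mA cA]; rewrite setTD; split; first exact: measurableC.
  exact: almost_clopenC.
- move=> F FC; split; first by apply: bigcupT_measurable => n; have [] := FC n.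
  by apply: almost_clopen_bigcup => n; have [] := FC n.
Qed.

Lemma fib_measurable_separated {I : finType} (U : borelType X -> I) (d : R) :
  fib_measurable U -> (0 < d)%R ->
  exists (e : R) (N : set (borelType X)), [/\ (0 < e)%R, measurable N, mu N < d%:E &
    forall x y : X, ~ N x -> ~ N y -> (mdist x y <= e)%R -> U x = U y].
Proof.
move=> mU d0.
have [e [N [e0 mN Nd sep]]] : exists (e : R) (N : set (borelType X)),
    [/\ (0 < e)%R, measurable N, mu N < d%:E &
    forall x y : X, ~ N x -> ~ N y -> (mdist x y <= e)%R ->
    forall i, i \in enum I -> U x = i -> U y = i].
  elim: (enum I) d d0 => [|i s ih] d d0.
    by exists 1%R, set0; split => //; rewrite measure0 lte_fin.
  have d20 : (0 < d / 2)%R by rewrite divr_gt0.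
  have [e [N [e0 mN Nd sA]]] := measurable_almost_clopen _ (mU i) _ d20.
  have [e' [N' [e'0 mN' N'd sB]]] := ih _ d20.
  exists (Num.min e e'), (N `|` N'); split.
  - by rewrite lt_min e0.
  - exact: measurableU.
  - apply: le_lt_trans (measureU2 mu mN mN') _.
    by rewrite [d]splitr EFinD lteD.
  - move=> x y /not_orP[Nx N'x] /not_orP[Ny N'y]; rewrite le_min => /andP[xy xy'] j.
    by rewrite in_cons => /predU1P[->|/sB]; [exact: sA|apply].
by exists e, N; split => // x y Nx Ny xy; apply/esym/(sep x y) => //; rewrite mem_enum.
Qed.

End separation_of_measurable_sets.

(** * Entropy of itineraries under a stationary measure *)

Section stationary.
Context {R : realType} {X : pmetricType R} {m : nat}.
Context {f : 'I_m.+1 -> X -> X} {mu : probability (borelType X) R}.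
Context {P : probability (Sigma m) R} {p : 'I_m.+1 -> R}.
Hypotheses (compX : compact [set: X]) (contf : forall i, continuous (f i)).
Hypotheses (p_gt0 : forall i, 0 < p i) (sum_p : \sum_i p i = 1).
Hypothesis bernP : is_bernoulli p P.
Hypothesis invmu : G_invariant f P mu.
Implicit Types (w : Sigma m) (k l : nat) (e : R) (x : X).

Local Notation ent U := (entropy (mu := mu) (T := borelType X) U).
Local Notation shiftn k w := (iter k (@Defs.shift m) w).

Lemma continuous_borel (g : X -> X) : continuous g ->
  measurable_fun [set: borelType X] (g : borelType X -> borelType X).
Proof.
move=> cg; apply: (@measurability _ _ (borelType X) (borelType X) setT _ (@open X)) => //.
move=> _ [U oU <-]; rewrite setTI; apply: sub_sigma_algebra.
by move/continuousP : cg; exact.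
Qed.

Lemma fib_measurable_continuous {I : finType} (U : X -> I) (g : X -> X) :
  continuous g -> fib_measurable (T := borelType X) U ->
  fib_measurable (T := borelType X) (U \o g).
Proof.
move=> /continuous_borel mg mU i; rewrite -[X in measurable X]setTI.
exact: (mg measurableT _ (mU i)).
Qed.

Lemma fib_measurable_orbit {I : finType} (U : X -> I) w k :
  fib_measurable (T := borelType X) U ->
  fib_measurable (T := borelType X) (U \o orbit_map f w k).
Proof. by apply: fib_measurable_continuous; exact: continuous_orbit_map. Qed.

(** Invariance of [P \x mu] says that [mu] is stationary: it is the average of
    its images under the generators. *)
Lemma stationary (A : set (borelType X)) : measurable A ->
  (mu A = \sum_i (p i)%:E * mu (f i @^-1` A))%E.
Proof.
move=> mA; have := invmu _ (measurableX (@measurableT _ (Sigma m)) mA).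
rewrite [RHS]product_measure1E//= probability_setT mul1e => <-.
rewrite /product_measure1.
have mfA i : measurable (f i @^-1` A : set (borelType X)).
  by rewrite -[X in measurable X]setTI; exact: (continuous_borel _ (contf i) measurableT _ mA).
transitivity (\int[P]_w mu (f (w 0%N) @^-1` A))%E.
  apply: eq_integral => w _ /=; congr (mu _).
  by apply/seteqP; split => x /=; rewrite /xsection /= in_setE => //= -[].
rewrite (integral_bernoulli_cons p_gt0 sum_p bernP)//; last first.
  by apply: (measurable_fun_prefix_dep _ _ 1) => w w' ww'; rewrite ww'.
apply: eq_bigr => i _; congr (_ * _)%E.
exact: (@integral_probability_cst _ _ _ P (mu (f i @^-1` A))).
Qed.

Lemma law_stationary {I : finType} (U : X -> I) i :
  fib_measurable (T := borelType X) U ->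
  law (mu := mu) (T := borelType X) U i =
  \sum_j p j * law (mu := mu) (T := borelType X) (U \o f j) i.
Proof.
move=> mU; apply: EFin_inj; rewrite -lawE// stationary// -sumEFin.
apply: eq_bigr => j _; rewrite EFinM -lawE//.
exact: fib_measurable_continuous.
Qed.

(** Entropy is a concave function of the law, and the law of [U] is the average
    of the laws of [U \o f j]. *)
Lemma entropy_stationary_le {I : finType} (U : X -> I) :
  fib_measurable (T := borelType X) U ->
  \sum_j p j * ent (U \o f j) <= ent U.
Proof.
move=> mU; rewrite /entropy.
under eq_bigr do rewrite mulr_sumr.
rewrite exchange_big/=; apply: ler_sum => i _.
have lawU := law_stationary U i mU.
set t := law (mu := mu) (T := borelType X) U i in lawU *; pose s j := law (mu := mu) (T := borelType X) (U \o f j) i.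
have [t0|t0] := eqVneq t 0.
  rewrite t0 mul0r oppr0 big1// => j _.
  have : p j * s j = 0.
    apply/eqP; move: lawU; rewrite t0 => /esym/eqP; rewrite psumr_eq0.
      by move=> /allP/(_ j (mem_index_enum _)).
    by move=> j' _; rewrite mulr_ge0 ?law_ge0// ltW.
  by rewrite -/(s j) mulrN mulrA => ->; rewrite mul0r oppr0.
have {}t0 : 0 < t by rewrite lt_neqAle eq_sym t0 law_ge0.
apply: (@le_trans _ _ (\sum_j p j * (- (s j * ln t) + t - s j))).
  apply: ler_sum => j _; rewrite ler_wpM2l ?(ltW (p_gt0 j))//.
  by apply: entropy_tangent => //; exact: law_ge0.
rewrite (eq_bigr (fun j => p j * s j * - (ln t + 1) + p j * t)); last first.
  by move=> j _; ring.
rewrite big_split/= -mulr_suml -lawU -mulr_suml sum_p.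
by rewrite le_eqVlt; apply/orP; left; apply/eqP; ring.
Qed.

Local Open Scope ereal_scope.

Let prefix_dep_ent {I : finType} k (U : Sigma m -> X -> I) :
  prefix_dep k U -> prefix_dep k (fun w => ent (U w)).
Proof. by move=> dU w w' ww'; rewrite (dU w w'). Qed.

Let ment {I : finType} k (U : Sigma m -> X -> I) : prefix_dep k U ->
  measurable_fun [set: Sigma m] (fun w => (ent (U w))%:E).
Proof.
move=> dU; apply/measurable_EFinP.
exact: (measurable_fun_prefix_dep _ _ k _ (prefix_dep_ent k U dU)).
Qed.

Let prefix_dep_compose {I : finType} k l (U : Sigma m -> X -> I) :
  prefix_dep l U ->
  prefix_dep (k + l) (fun w => U (shiftn k w) \o orbit_map f w k).
Proof.
move=> dU w w' ww'.
rewrite (prefix_dep_orbit_map f (k + l) k (leq_addr _ _) w w')//.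
by rewrite (prefix_dep_iter_shift k l U dU w w').
Qed.

(** One step at a time: the first letter is independent of the shifted word, so
    integrating it out leaves the average over [j] of the entropies along [f j],
    which concavity bounds. *)
Lemma integral_entropy_orbit_le {I : finType} k l (U : Sigma m -> X -> I) :
  prefix_dep l U -> (forall w, fib_measurable (T := borelType X) (U w)) ->
  \int[P]_w (ent (U (shiftn k w) \o orbit_map f w k))%:E <= \int[P]_w (ent (U w))%:E.
Proof.
move=> dU mU; elim: k => [|k ih]; first exact: le_refl.
apply: le_trans ih; pose V w := U (shiftn k w) \o orbit_map f w k.
have dV : prefix_dep (k + l) V by exact: prefix_dep_compose.
have mV w : fib_measurable (T := borelType X) (V w) by exact: fib_measurable_orbit.
have mVf w j : fib_measurable (T := borelType X) (V w \o f j).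
  exact: fib_measurable_continuous.
have e0 w : 0 <= (ent (V w))%:E by rewrite lee_fin entropy_ge0.
have ef0 j w : 0 <= (ent (V w \o f j))%:E by rewrite lee_fin entropy_ge0.
have mef j : measurable_fun [set: Sigma m] (fun w => (ent (V w \o f j))%:E).
  by apply: (ment (k + l)) => w w' ww'; rewrite (dV w w').
have VE j w : U (shiftn k.+1 (cons_word j w)) \o orbit_map f (cons_word j w) k.+1 =
    V w \o f j.
  rewrite /V iterSr; apply/funext => x /=.
  by rewrite -[X in U _ X]/(orbit_map f (cons_word j w) k.+1 x) orbit_map_cons.
rewrite (integral_bernoulli_cons p_gt0 sum_p bernP)//; last 2 first.
- apply: (ment (k.+1 + l) (fun w => U (shiftn k.+1 w) \o orbit_map f w k.+1)).
  exact: prefix_dep_compose.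
- move=> w; rewrite lee_fin entropy_ge0//.
  exact: fib_measurable_orbit.
apply: (@le_trans _ _ (\int[P]_w (\sum_j (p j)%:E * (ent (V w \o f j))%:E))).
  rewrite ge0_integral_sum//; last 2 first.
  - by move=> j; apply: measurable_funeM.
  - by move=> j w _; rewrite mule_ge0// lee_fin ltW.
  apply: lee_sum => j _; rewrite ge0_integralZl//; last by rewrite lee_fin ltW.
  by rewrite le_eqVlt; apply/orP; left; apply/eqP; congr (_ * _);
    apply: eq_integral => w _; rewrite -VE.
apply: ge0_le_integral => //.
- by move=> w _; rewrite sume_ge0// => j _; rewrite mule_ge0// lee_fin ltW.
- by apply: emeasurable_sum => j; apply: measurable_funeM.
- exact: ment dV.
- move=> w _; under eq_bigr do rewrite -EFinM.
  by rewrite sumEFin lee_fin entropy_stationary_le.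
Qed.

Section partition.
Variables (n : nat) (cell : X -> 'I_n).
Hypothesis mcell : fib_measurable (T := borelType X) cell.

Definition itinerary w k x : {ffun 'I_k -> 'I_n} :=
  [ffun i : 'I_k => cell (orbit_map f w i x)].

Lemma fib_measurable_itinerary w k : fib_measurable (T := borelType X) (itinerary w k).
Proof.
apply: (@fib_measurable_ffun _ (borelType X) _ _ (fun (i : 'I_k) x => cell (orbit_map f w i x))).
by move=> i; exact: fib_measurable_orbit.
Qed.

Lemma prefix_dep_itinerary k : prefix_dep k (fun w => itinerary w k).
Proof.
move=> w w' ww'; apply/funext => x; apply/ffunP => i; rewrite !ffunE.
by rewrite (prefix_dep_orbit_map f k i (ltnW (ltn_ord i)) w w').
Qed.

Definition itinerary_rate k : \bar R :=
  (k%:R^-1)%:E * \int[P]_w (ent (itinerary w k))%:E.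

(** An itinerary of length [k + l] is the pair of an itinerary of length [k] and
    one of length [l] started at time [k], whose mean entropy does not exceed
    that of an itinerary started at time [0]. *)
Lemma itinerary_rate_esup_einf : limn_esup itinerary_rate <= limn_einf itinerary_rate.
Proof.
apply: (fekete_integral (P := P) (fun k w => ent (itinerary w k))).
- by move=> k; apply: prefix_dep_ent; exact: prefix_dep_itinerary.
- by move=> k w; apply: entropy_ge0; exact: fib_measurable_itinerary.
move=> k l.
have mit j w : fib_measurable (T := borelType X) (itinerary w j).
  exact: fib_measurable_itinerary.
apply: le_trans (leeD2l _ (integral_entropy_orbit_le k l (fun w => itinerary w l)
  (prefix_dep_itinerary l) (mit l))).
have mitk w : fib_measurable (T := borelType X)
    (itinerary (shiftn k w) l \o orbit_map f w k) by exact: fib_measurable_orbit.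
have mk1 : measurable_fun [set: Sigma m] (fun w => (ent (itinerary w k))%:E).
  exact: (ment k (fun w => itinerary w k) (prefix_dep_itinerary k)).
have mk2 : measurable_fun [set: Sigma m]
   (fun w => (ent (itinerary (shiftn k w) l \o orbit_map f w k))%:E).
  apply: (ment (k + l) (fun w => itinerary (shiftn k w) l \o orbit_map f w k)).
  exact: (prefix_dep_compose k l (fun w => itinerary w l) (prefix_dep_itinerary l)).
rewrite -ge0_integralD//; [|by move=> w _; rewrite lee_fin entropy_ge0..].
apply: ge0_le_integral => //.
- by move=> w _; rewrite lee_fin entropy_ge0.
- exact: (ment (k + l) (fun w => itinerary w (k + l)) (prefix_dep_itinerary _)).
- exact: emeasurable_funD.
move=> w _; rewrite -EFinD lee_fin.
apply: le_trans (entropy_pair_le _ _ (mit k w) (mitk w)).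
apply: entropy_determined_le; first exact: fib_measurable_pair.
move=> x y [/ffunP h1 /ffunP h2]; apply/ffunP => i; rewrite !ffunE.
have [ik|ki] := ltnP i k; first by have := h1 (Ordinal ik); rewrite !ffunE.
have il : (i - k < l)%N by have := ltn_ord i; lia.
have := h2 (Ordinal il); rewrite !ffunE/= -!orbit_mapD.
by rewrite subnKC.
Qed.

(** Outside a set [N] of measure less than [d], nearby points have the same
    cell. So the itinerary of [x] is determined by the point of a maximal
    separated set that shadows it, together with the cells visited while the
    orbit is inside [N]. The former contributes at most the topological entropy;
    the latter costs per unit of time the entropy of a variable that is constant
    off [N], which is the error term. *)
Lemma itinerary_rate_le (d : R) : (0 < d)%R ->
  limn_einf itinerary_rate <=
  top_entropy f P + (d + n%:R * (2 * Num.sqrt d))%:E.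
Proof.
move=> d0; set c := (d + _)%R.
have [e [N [e0 mN Nd sep]]] := fib_measurable_separated (mu := mu) (cell : borelType X -> _) d mcell d0.
pose bad x : option 'I_n := if `[< N x >] then Some (cell x) else None.
have mbad : fib_measurable (T := borelType X) bad.
  apply: (fib_measurable_comp (T := borelType X)
    (fun bc => if bc.1 then Some bc.2 else None)
    (fun x : X => (`[< N x >], cell x))).
  apply: fib_measurable_pair => // -[].
    rewrite (_ : _ @^-1` _ = N)//; apply/seteqP; split => x /=.
      by move/asboolP.
    by move=> ?; apply/asboolP.
  rewrite (_ : _ @^-1` _ = ~` N); first exact: measurableC.
  apply/seteqP; split => x /=; first by move/asboolP.
  by move=> ?; apply/asboolP.
have c0 : (0 <= c)%R by rewrite /c addr_ge0 ?(ltW d0)// !mulr_ge0// sqrtr_ge0.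
have ent_bad : (ent bad <= c)%R.
  have := entropy_option_le (mu := mu) bad d mbad; rewrite card_ord; apply.
  have -> : law (mu := mu) (T := borelType X) bad None = (1 - fine (mu N))%R.
    apply: EFin_inj; rewrite -lawE// EFinB fineK ?fin_num_measure//.
    rewrite -probability_setC//; congr (mu _).
    apply/seteqP; split => x; rewrite /bad /=; first by case: asboolP.
    by case: asboolP.
  by rewrite subKr ltW// -lte_fin fineK ?fin_num_measure.
pose e2 := (e / 2)%R; have e20 : (0 < e2)%R by rewrite divr_gt0.
have key w k : (ent (itinerary w k))%:E <= lne (max_separated_card f w k e2) +
    \sum_(i < k) (ent (bad \o orbit_map f w i))%:E.
  have [E [_ -> E0 net]] := maximal_separated f contf compX w k e2 e20.
  have [z0 z0E _] := net point.
  pose near (x : X) : {ffun E -> bool} :=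
    [ffun z : E => (bowen_dist f w k (val z) x <= e2)%R].
  pose D := (fun b : {ffun E -> bool} => odflt [` z0E]%fset [pick z | b z]) \o near.
  have mD : fib_measurable (T := borelType X) D.
    apply: fib_measurable_comp; apply: (@fib_measurable_ffun _ (borelType X)).
    move=> z; have mB : measurable (bowen_ball f w k (val z) e2 : set (borelType X)).
      exact: measurable_bowen_ball.
    case; first exact: mB.
    rewrite (_ : _ @^-1` _ = ~` bowen_ball f w k (val z) e2); first exact: measurableC.
    apply/seteqP; split => x; rewrite /bowen_ball/=; first by move=> ->.
    by move/negP/negbTE.
  have Dnear x : (bowen_dist f w k (val (D x)) x <= e2)%R.
    rewrite /D /=; case: pickP => [z /=|no]; first by rewrite ffunE.
    have [z zE zx] := net x.
    by have := no [` zE]%fset; rewrite ffunE zx.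
  pose visits x := [ffun i : 'I_k => bad (orbit_map f w i x)].
  have mbado i : fib_measurable (T := borelType X) (bad \o orbit_map f w i).
    exact: fib_measurable_orbit.
  have mvisits : fib_measurable (T := borelType X) visits.
    apply: (@fib_measurable_ffun _ (borelType X) _ _
      (fun (i : 'I_k) x => bad (orbit_map f w i x))) => i.
    exact: mbado.
  rewrite lne_EFin ?ltr0n// sumEFin -EFinD lee_fin.
  apply: (@le_trans _ _ (ent (fun x => (D x, visits x)))).
    apply: entropy_determined_le; first exact: fib_measurable_pair.
    move=> x y [Dxy /ffunP vxy]; apply/ffunP => i; rewrite !ffunE.
    have := vxy i; rewrite !ffunE /bad.
    case: asboolP => Nx; case: asboolP => Ny //; first by case.
    move=> _; apply: sep => //; apply: le_trans (le_bowen_dist f w k x y i (ltn_ord i)) _.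
    apply: le_trans (bowen_dist_triangle f w k x (val (D x)) y) _.
    rewrite [e]splitr lerD//; first by rewrite bowen_dist_sym.
    by rewrite Dxy.
  apply: le_trans (entropy_pair_le _ _ mD mvisits) _; apply: lerD.
    by apply: entropy_le_card; rewrite // cardfE.
  exact: (@entropy_ffun_le _ (borelType X) _ _ _ k (fun i => bad \o orbit_map f w i)).
have rate_le k : itinerary_rate k <= log_sep_rate f (P := P) e2 k + c%:E.
  have bad_ge0 w i : 0 <= (ent (bad \o orbit_map f w i))%:E.
    by rewrite lee_fin entropy_ge0//; exact: fib_measurable_orbit.
  have dbad i : prefix_dep i (fun w => bad \o orbit_map f w i).
    by move=> w w' ww'; rewrite (prefix_dep_orbit_map f i i (leqnn i) w w').
  have mbadi i : measurable_fun [set: Sigma m]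
      (fun w => (ent (bad \o orbit_map f w i))%:E).
    exact: (ment i (fun w => bad \o orbit_map f w i) (dbad i)).
  have mE : measurable_fun [set: Sigma m] (fun w => lne (max_separated_card f w k e2)).
    exact: measurable_lne_max_separated_card.
  have mS : measurable_fun [set: Sigma m]
      (fun w => \sum_(i < k) (ent (bad \o orbit_map f w i))%:E).
    by apply: emeasurable_sum => i; exact: mbadi.
  have lne0 w : 0 <= lne (max_separated_card f w k e2).
    by rewrite lne_ge0 max_separated_card_ge1.
  have int_le : \int[P]_w (ent (itinerary w k))%:E <=
      \int[P]_w lne (max_separated_card f w k e2) + (k%:R * c)%:E.
    apply: (@le_trans _ _ (\int[P]_w (lne (max_separated_card f w k e2) +
        \sum_(i < k) (ent (bad \o orbit_map f w i))%:E))).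
      apply: ge0_le_integral.
      - exact: measurableT.
      - by move=> w _; rewrite lee_fin entropy_ge0//; exact: fib_measurable_itinerary.
      - exact: (ment k (fun w => itinerary w k) (prefix_dep_itinerary k)).
      - exact: emeasurable_funD.
      - by move=> w _; exact: key.
    rewrite ge0_integralD//; last first.
      by move=> w _; rewrite sume_ge0.
    apply: leeD2l; rewrite ge0_integral_sum//.
    rewrite mulr_natl -[X in (c *+ X)%R](card_ord k) -sumr_const -sumEFin.
    apply: lee_sum => i _.
    apply: le_trans (integral_entropy_orbit_le i 0 (fun=> bad) _ _) _ => //.
    by rewrite (@integral_probability_cst _ _ _ P) lee_fin.
  rewrite /itinerary_rate /log_sep_rate.
  apply: le_trans (lee_wpmul2l _ int_le) _; first by rewrite lee_fin invr_ge0.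
  rewrite ge0_muleDr; last 2 first.
  - exact: integral_ge0.
  - by rewrite lee_fin mulr_ge0.
  apply: leeD2l; rewrite -EFinM lee_fin mulrA.
  have [->|k0] := posnP k; first by rewrite mulr0 mul0r.
  by rewrite mulVf ?mul1r// pnatr_eq0 -lt0n.
apply: le_trans (le_limn_einf _ _ rate_le) _.
under eq_fun do rewrite addeC.
rewrite limn_einf_shift// addeC leeD2r//.
exact: le_top_entropy.
Qed.

End partition.

End stationary.

(** * Measure-theoretic entropy *)

Section measure_entropy.
Context {R : realType} {X : pmetricType R} {m : nat}.
Context {f : 'I_m.+1 -> X -> X} {mu : probability (borelType X) R}.
Context {P : probability (Sigma m) R} {p : 'I_m.+1 -> R}.
Hypotheses (compX : compact [set: X]) (contf : forall i, continuous (f i)).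
Hypotheses (p_gt0 : forall i, 0 < p i) (sum_p : \sum_i p i = 1).
Hypothesis bernP : is_bernoulli p P.
Implicit Types (w : Sigma m) (k : nat) (e : R) (x : X).
Local Open Scope ereal_scope.

Local Notation ent U := (entropy (mu := mu) (T := borelType X) U).
Local Notation fibm := (fib_measurable (T := borelType X)).

Lemma shannon_entropyE {I : finType} (U : X -> I) : fibm U ->
  shannon_entropy mu (fun i => U @^-1` [set i]) = (ent U)%:E.
Proof.
move=> mU; rewrite /shannon_entropy /entropy sumrN EFinN -sumEFin.
congr (- _); apply: eq_bigr => i _; rewrite lawE//.
have [->|u0] := eqVneq (law (mu := mu) (T := borelType X) U i) 0%R.
  by rewrite !mul0r mul0e.
rewrite lne_EFin// lt_neqAle eq_sym u0; exact: law_ge0.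
Qed.

Lemma partition_entropyE n (cell : X -> 'I_n) : fibm cell ->
  partition_entropy f P mu (fun i => cell @^-1` [set i]) =
  limn (itinerary_rate (f := f) (mu := mu) (P := P) n cell).
Proof.
move=> mcell; congr (limn _); apply/funext => k; congr (_ * _).
apply: eq_integral => w _.
rewrite -shannon_entropyE; last exact: fib_measurable_itinerary.
congr shannon_entropy; apply/funext => s; apply/seteqP; split => x /=.
  by move=> h; apply/ffunP => i; rewrite ffunE; exact: h.
by move=> <- i _ /=; rewrite ffunE.
Qed.

Lemma integral_finite_valued {I : finType} (W : X -> I) (h : I -> R) :
  fibm W -> (forall i, 0 <= h i)%R ->
  \int[mu]_x (h (W x))%:E = (\sum_i h i * law (mu := mu) (T := borelType X) W i)%:E.
Proof.
move=> mW h0; rewrite -sumEFin.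
have mi i : measurable_fun [set: borelType X]
    (fun x => (\1_(W @^-1` [set i] : set (borelType X)) x)%:E).
  by apply/measurable_EFinP; exact: measurable_indic.
rewrite (eq_integral (fun x : borelType X =>
    \sum_i (h i)%:E * (\1_(W @^-1` [set i] : set (borelType X)) x)%:E)).
  rewrite ge0_integral_sum//; last 2 first.
  - by move=> i; exact: measurable_funeM.
  - by move=> i x _; rewrite mule_ge0// lee_fin.
  apply: eq_bigr => i _; rewrite ge0_integralZl//; last by rewrite lee_fin.
  by rewrite integral_indic//= setIT lawE// EFinM.
move=> x _; rewrite (bigD1 (W x))//= big1 ?adde0 => [|i iW].
  by rewrite indicE mem_set// mule1.
by rewrite indicE memNset ?mule0//= => /esym/eqP; rewrite (negbTE iW).
Qed.

(** If the cells of [W] lie in balls, the information of a ball is at most that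
    of the cell of its centre, outside the null cells. *)
Lemma renyi_info1_le_entropy {I : finType} (W : X -> I) w k e : (0 < e)%R ->
  full_support mu -> fibm W ->
  (forall x y, W x = W y -> (bowen_dist f w k x y <= e)%R) ->
  renyi_info f mu 1 w k e <= (ent W)%:E.
Proof.
move=> e0 suppmu mW We.
pose l i : R := law (mu := mu) (T := borelType X) W i.
have lnl i : (0 <= - ln (l i))%R by rewrite oppr_ge0 ln_le0// law_le1.
rewrite /renyi_info eqxx /entropy.
rewrite (eq_bigr (fun i => - ln (l i) * l i)%R); last by move=> i _; rewrite mulNr mulrC.
rewrite -integral_finite_valued//.
have minv : measurable_fun [set: borelType X] (fun x => (ln (inv_mass f mu w k e x))%:E).
  apply/measurable_EFinP; apply: (measurableT_comp (@measurable_ln R)).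
  exact: measurable_inv_mass.
have ml : measurable_fun [set: borelType X] (fun x : borelType X => (- ln (l (W x)))%:E).
  apply/measurable_EFinP => _ A mA; rewrite setTI.
  pose psi i := `[< A (- ln (l i))%R >].
  rewrite (_ : _ @^-1` A = (psi \o W) @^-1` [set true]); first exact: fib_measurable_comp.
  by apply/seteqP; split => x /=; [move=> ?; apply/asboolP|move/asboolP].
apply: ae_ge0_le_integral => //.
- by move=> x _; rewrite lee_fin ln_ge0// inv_mass_ge1.
- by move=> x _; rewrite lee_fin.
pose null := (fun i => l i == 0%R) \o W.
have mnull : fibm null by exact: fib_measurable_comp.
exists (null @^-1` [set true]); split.
- exact: mnull.
- transitivity ((law (mu := mu) (T := borelType X) null true)%:E).
    exact: lawE mnull.
  by rewrite law_comp// big1// => i /eqP/eqP.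
- move=> x /= h; apply: contrapT => /negP/eqP/eqP l0; apply: h => _.
  have {}l0 : (0 < l (W x))%R by rewrite lt_neqAle eq_sym l0 law_ge0.
  rewrite lee_fin -lnV ?posrE// ler_ln ?posrE ?inv_mass_gt0 ?invr_gt0//.
  rewrite lef_pV2 ?posrE ?ball_mass_gt0//.
  rewrite -lee_fin -lawE// -ball_massE//; apply: le_measure; rewrite ?inE;
    [exact: mW|exact: measurable_bowen_ball|].
  by move=> y /= Wy; apply: We.
Qed.

(** Classify points by the balls of a finite net that contain them. Classes that
    are empty are dropped, since the cells of a partition are nonempty. *)
Lemma small_partition e : (0 < e)%R -> exists n (cell : X -> 'I_n),
  [/\ fibm cell, forall i, cell @^-1` [set i] !=set0 &
      forall x y : X, cell x = cell y -> (mdist x y <= e)%R].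
Proof.
move=> e0; have e20 : (0 < e / 2)%R by rewrite divr_gt0.
pose w0 : nat -> 'I_m.+1 := fun=> ord0.
have [F net] := bowen_net f contf compX w0 1 _ e20.
pose near (x : X) : {ffun F -> bool} :=
  [ffun z : F => (bowen_dist f w0 1 (val z) x <= e / 2)%R].
have mnear : fibm near.
  apply: (@fib_measurable_ffun _ (borelType X)) => z.
  have mB : measurable (bowen_ball f w0 1 (val z) (e / 2) : set (borelType X)).
    exact: measurable_bowen_ball.
  case; first exact: mB.
  rewrite (_ : _ @^-1` _ = ~` bowen_ball f w0 1 (val z) (e / 2)).
    exact: measurableC.
  apply/seteqP; split => x; rewrite /bowen_ball/=; first by move=> ->.
  by move/negP/negbTE.
pose A := [set b | `[< exists x, near x = b >]].
have nearA x : near x \in A by rewrite inE; apply/asboolP; exists x.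
pose cell x := enum_rank_in (nearA point) (near x).
exists #|A|, cell; split.
- exact: (fib_measurable_comp (T := borelType X) (enum_rank_in (nearA point)) near).
- move=> i; have := enum_valP i; rewrite inE => /asboolP[x xi].
  by exists x; rewrite /cell /= xi enum_valK_in.
move=> x y /(congr1 enum_val); rewrite !enum_rankK_in// => /ffunP xy.
have [z zF zx] := net x.
have := xy [` zF]%fset; rewrite !ffunE/= zx => /esym zy.
have := le_bowen_dist f w0 1 x y 0 isT; move=> /le_trans; apply.
rewrite [e]splitr; apply: le_trans (bowen_dist_triangle f w0 1 x z y) _.
by rewrite lerD// bowen_dist_sym.
Qed.

Hypothesis suppmu : full_support mu.
Hypothesis invmu : G_invariant f P mu.

Local Notation itin_rate := (itinerary_rate (f := f) (mu := mu) (P := P)).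

(** The entropy of a partition is defined as a limit, which exists by
    subadditivity. *)
Let itinerary_rate_lim n (cell : X -> 'I_n) : fibm cell ->
  limn (itin_rate n cell) = limn_einf (itin_rate n cell).
Proof.
move=> mcell; have le_sup := itinerary_rate_esup_einf contf p_gt0 sum_p bernP invmu n cell mcell.
apply/cvg_lim => //; apply: (@squeeze_cvge _ _ _ _ (einfs (itin_rate n cell)) _
  (esups (itin_rate n cell))).
- apply: nearW => k; apply/andP; split.
    by apply: ereal_inf_lbound; exists k => /=.
  by apply: ereal_sup_ubound; exists k => /=.
- by rewrite limn_einfE; exact: cvg_einfs_sup.
- rewrite (_ : limn_einf _ = limn_esup (itin_rate n cell)).
    by rewrite limn_esupE; exact: cvg_esups_inf.
  by apply/eqP; rewrite eq_le limn_einf_sup.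
Qed.

Lemma partition_entropy_le n (cell : X -> 'I_n) : fibm cell ->
  partition_entropy f P mu (fun i => cell @^-1` [set i]) <= top_entropy f P.
Proof.
move=> mcell; rewrite partition_entropyE// itinerary_rate_lim//.
apply/lee_addgt0Pr => h h0.
(* [d <= s ^+ 2] makes the term in [sqrt d] at most [h / 2]. *)
pose s := (h / (4 * n.+1%:R))%R; pose d := (Num.min (h / 2) (s ^+ 2))%R.
have s0 : (0 < s)%R by rewrite divr_gt0// mulr_gt0.
have d0 : (0 < d)%R by rewrite lt_min divr_gt0// exprn_gt0.
apply: le_trans (itinerary_rate_le compX contf p_gt0 sum_p bernP invmu n cell mcell d d0) _.
apply: leeD2l; rewrite lee_fin [leRHS]splitr lerD//; first by rewrite ge_min lexx.
have sd : (Num.sqrt d <= s)%R.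
  apply: (@le_trans _ _ (Num.sqrt (s ^+ 2))).
    by rewrite ler_wsqrtr// ge_min lexx orbT.
  by rewrite sqrtr_sqr ger0_norm// ltW.
apply: (@le_trans _ _ (n.+1%:R * (2 * s))%R).
  by apply: ler_pM => //; rewrite ?mulr_ge0 ?sqrtr_ge0 ?ler_nat// ler_wpM2l.
by rewrite le_eqVlt; apply/orP; left; apply/eqP; rewrite /s; field; rewrite ?natr1 ?nat1r pnatr_eq0.
Qed.

(** With cells of diameter at most [e], points with the same itinerary lie in the
    same Bowen ball, so itineraries carry at least the information of the
    balls. *)
Lemma le_measure_entropy e : (0 < e)%R ->
  limn_einf (renyi_rate f mu P 1 e) <= measure_entropy f P mu.
Proof.
move=> e0; have [n [cell [mcell cell0 cell_e]]] := small_partition e e0.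
apply: (@le_trans _ _ (partition_entropy f P mu (fun i => cell @^-1` [set i]))).
  rewrite partition_entropyE// itinerary_rate_lim//; apply: le_limn_einf => k.
  apply: lee_wpmul2l; first by rewrite lee_fin invr_ge0.
  have mit w : fibm (itinerary (f := f) n cell w k) by exact: fib_measurable_itinerary.
  apply: ge0_le_integral.
  - exact: measurableT.
  - by move=> w _; apply: renyi_info_ge0 => //; rewrite ler01 lexx.
  - exact: measurable_renyi_info.
  - apply/measurable_EFinP; apply: (measurable_fun_prefix_dep _ _ k) => w w' ww'.
    by rewrite (prefix_dep_itinerary (f := f) n cell k w w').
  - move=> w _; apply: renyi_info1_le_entropy => //.
    move=> x y /ffunP xy; apply/bowen_distP; first exact: ltW.
    move=> i ik; apply: cell_e.
    by have := xy (Ordinal ik); rewrite !ffunE.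
apply: ereal_sup_ubound; exists n, (fun i => cell @^-1` [set i]); split => //.
split.
- by apply/seteqP; split => // x _; exists (cell x).
- by move=> i j _ _ [x [/= <- <-]].
- by move=> i _; exact: cell0.
Qed.

Lemma measure_entropy_le : measure_entropy f P mu <= top_entropy f P.
Proof.
apply: ge_ereal_sup => _ [n [xi [mxi [xiT xi_triv _] ->]]].
have /choice[cell cellP] : forall x : X, exists i, xi i x.
  by move=> x; have : [set: X] x by []; rewrite -xiT => -[i _ xix]; exists i.
have -> : xi = (fun i => cell @^-1` [set i]).
  apply/funext => i; apply/seteqP; split => x /= h; last by rewrite -h.
  by apply: (xi_triv (cell x) i) => //; exists x; split.
apply: partition_entropy_le => i.
rewrite (_ : _ @^-1` _ = xi i) ?mxi//; apply/seteqP; split => x /= h.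
  by rewrite -h.
by apply: (xi_triv (cell x) i) => //; exists x; split.
Qed.

End measure_entropy.

(** * Equality of the entropies *)

Theorem theorem1p4 (R : realType) (X : pmetricType R) (m : nat)
    (f : 'I_m.+1 -> X -> X) (p : 'I_m.+1 -> R)
    (P : probability (Sigma m) R) (mu : probability (borelType X) R) :
  compact [set: X] ->
  (forall i, continuous (f i)) ->
  (forall i, 0 < p i) ->
  \sum_i p i = 1 ->
  is_bernoulli p P ->
  full_support mu ->
  {ae (P \x mu)%E, forall z, (top_entropy f P <= local_entropy f mu z.1 z.2)%E} ->
  (forall q : R, 0 <= q <= 1 ->
     upper_correlation_entropy f P mu q = lower_correlation_entropy f P mu q /\
     top_entropy f P = upper_correlation_entropy f P mu q) /\
  (G_invariant f P mu ->
     top_entropy f P = upper_correlation_entropy f P mu 1 /\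
     upper_correlation_entropy f P mu 1 = lower_correlation_entropy f P mu 1 /\
     top_entropy f P = measure_entropy f P mu).
Proof.
move=> compX contf p_gt0 sum_p bernP suppmu ae_local.
have cor q (q01 : 0 <= q <= 1) :=
  correlation_entropy_top compX contf suppmu p_gt0 sum_p bernP q ae_local q01.
have q11 : 0 <= (1 : R) <= 1 by rewrite ler01 lexx.
split => [q /cor[-> ->]//|invmu]; have [lo ->] := cor 1 q11.
split=> //; split; first exact/esym.
apply/eqP; rewrite eq_le; apply/andP; split; last first.
  exact: (measure_entropy_le compX contf p_gt0 sum_p bernP invmu).
rewrite -[leLHS]lo (lower_correlation_entropyE contf suppmu 1 q11).
apply: ge_ereal_sup => _ [e e0 <-].
exact: (le_measure_entropy compX contf p_gt0 sum_p bernP suppmu invmu e e0).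
Qed.
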